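(* Let $a\in[0,1)$ and $\alpha\in[0,2\pi)$. Let $f=h+\overline{g}$ be the harmonic right half-plane mapping on $\mathbb{D}$, with $h,g$ analytic and $h(0)=g(0)=0$, given by $$h(z)+g(z)=\frac{z}{1-z}$$ with dilatation $\omega(z)=\frac{g'(z)}{h'(z)}=-\frac{(a-z)^2}{(1-az)^2}$. Let $f_{a,\alpha}=h_{a,\alpha}+\overline{g_{a,\alpha}}$, where $$h_{a,\alpha}(z)=\frac{\frac{z}{1+a}-\frac12 e^{i\alpha}z^2}{(1-e^{i\alpha}z)^2},\qquad g_{a,\alpha}(z)=\frac{\frac{a e^{2i\alpha}z}{1+a}-\frac12 e^{3i\alpha}z^2}{(1-e^{i\alpha}z)^2}.$$ Then $f_{a,\alpha}*f\in\mathcal{S}_H^0$, and $f_{a,\alpha}*f$ is convex in the direction $-\alpha$.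
   Context: $\mathbb{D}=\{z\in\mathbb{C}:|z|<1\}$. A complex-valued harmonic function on $\mathbb{D}$ is written $f=h+\overline{g}$ with $h,g$ analytic on $\mathbb{D}$; its dilatation is $\omega=g'/h'$. $\mathcal{S}_H^0$ is the class of harmonic, sense-preserving, univalent (injective) mappings $f$ on $\mathbb{D}$ with $f(0)=0$, $f_z(0)=1$ and $f_{\bar z}(0)=0$. For analytic $\phi(z)=\sum_{k\ge1}a_kz^k$ and $\psi(z)=\sum_{k\ge1}b_kz^k$ on $\mathbb{D}$, $(\phi*\psi)(z)=\sum_{k\ge1}a_kb_kz^k$; for harmonic $f=h+\overline{g}$ and $F=H+\overline{G}$ (with $h,g,H,G$ vanishing at $0$), $f*F=h*H+\overline{g*G}$. For $\theta\in\mathbb{R}$, a domain is convex in the direction $\theta$ if its intersection with every line parallel to the line through $0$ and $e^{i\theta}$ is connected or empty; a univalent mapping of $\mathbb{D}$ is convex in the direction $\theta$ if its image is.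
   Formalization: For a>0 the convolution F has nonzero F_{z̄}(0), so F is not in S_H^0; instead F is shown harmonic, sense-preserving, univalent with F(0)=0, its affine normalization to F_z(0)=1, F_{z̄}(0)=0 is shown in S_H^0, and F itself is in S_H^0 when a=0. *)

(* Defs.v *)
From Stdlib Require Export Reals ClassicalEpsilon.
From Coquelicot Require Export Coquelicot.
#[global] Open Scope C_scope.

Definition cis (t : R) : C := (cos t, sin t).

Definition disk (z : C) : Prop := (Cmod z < 1)%R.

Definition analytic (phi : C -> C) : Prop :=
  forall z : C, disk z -> ex_derive (K := C_AbsRing) (V := C_NormedModule) phi z.

(* [taylor phi k] is the k-th coefficient of the power series of [phi] on the
   disk, and [CPSeries a z] the sum of [a k * z ^ k]; both are meaningful only
   when the series exists, resp. converges. *)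
Definition taylor (phi : C -> C) : nat -> C :=
  epsilon (inhabits (fun _ : nat => RtoC 0))
    (fun a => forall z : C, disk z ->
       is_pseries (K := C_AbsRing) (V := C_NormedModule) a z (phi z)).

Definition CPSeries (a : nat -> C) (z : C) : C :=
  iota (T := C_CompleteNormedModule)
    (fun l => is_pseries (K := C_AbsRing) (V := C_NormedModule) a z l).

(* Only used for functions vanishing at 0, for which the constant term is 0. *)
Definition hadamard (phi psi : C -> C) : C -> C :=
  CPSeries (fun k => taylor phi k * taylor psi k).

(* The pair (h, g) stands for h + conj g. *)
Record harmonic_pair := HarmonicPair { hpart : C -> C; gpart : C -> C }.

Definition heval (f : harmonic_pair) (z : C) : C := hpart f z + Cconj (gpart f z).
Coercion heval : harmonic_pair >-> Funclass.

Definition harmonic (f : harmonic_pair) : Prop :=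
  analytic (hpart f) /\ analytic (gpart f).

(* The Wirtinger derivatives of h + conj g. *)
Definition d_z (f : harmonic_pair) (z : C) : C := C_derive (hpart f) z.
Definition d_zbar (f : harmonic_pair) (z : C) : C := Cconj (C_derive (gpart f) z).

Definition has_dilatation (f : harmonic_pair) (omega : C -> C) : Prop :=
  forall z : C, disk z ->
    C_derive (hpart f) z <> 0 /\ C_derive (gpart f) z / C_derive (hpart f) z = omega z.

(* The Jacobian |f_z|^2 - |f_zbar|^2 is positive. *)
Definition sense_preserving (f : harmonic_pair) : Prop :=
  forall z : C, disk z -> (0 < Cmod (d_z f z) ^ 2 - Cmod (d_zbar f z) ^ 2)%R.

Definition univalent (f : C -> C) : Prop :=
  forall z w : C, disk z -> disk w -> f z = f w -> z = w.

Definition sense_preserving_univalent (f : harmonic_pair) : Prop :=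
  harmonic f /\ sense_preserving f /\ univalent f /\ f 0 = 0.

Definition S_H0 (f : harmonic_pair) : Prop :=
  sense_preserving_univalent f /\ d_z f 0 = 1 /\ d_zbar f 0 = 0.

(* The real-linear map w |-> (conj A * w - B * conj w) / (|A|^2 - |B|^2) with
   A = f_z(0), B = f_zbar(0), applied to the values of f.  It is the only
   real-linear map T such that T o f has f_z(0) = 1 and f_zbar(0) = 0, and it
   is the identity when A = 1 and B = 0. It is needed because the convolution
   f_{a,alpha} * f has f_z(0) = 1 / ((1 + a)^2 (1 - a)) and f_zbar(0) <> 0 when
   a > 0, so that it lies in S_H^0 itself only for a = 0. *)
Definition affine_normalization (f : harmonic_pair) : harmonic_pair :=
  let A := d_z f 0 in
  let B := d_zbar f 0 in
  let J := RtoC (Cmod A ^ 2 - Cmod B ^ 2)%R in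
  HarmonicPair
    (fun z => (Cconj A * hpart f z - B * gpart f z) / J)
    (fun z => (A * gpart f z - Cconj B * hpart f z) / J).

Definition hconv (f F : harmonic_pair) : harmonic_pair :=
  HarmonicPair (hadamard (hpart f) (hpart F)) (hadamard (gpart f) (gpart F)).

Definition image_of_disk (f : C -> C) (w : C) : Prop :=
  exists z : C, disk z /\ f z = w.

(* [is_connected] holds of the empty subset of R. *)
Definition domain_convex_in_direction (theta : R) (Omega : C -> Prop) : Prop :=
  forall w : C, is_connected (fun t : R => Omega (w + t * cis theta)).

Definition convex_in_direction (theta : R) (f : C -> C) : Prop :=
  univalent f /\ domain_convex_in_direction theta (image_of_disk f).

Definition f_slanted (a alpha : R) : harmonic_pair :=
  HarmonicPair
    (fun z => (z / (1 + a) - 1 / 2 * cis alpha * z ^ 2) / (1 - cis alpha * z) ^ 2)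
    (fun z => (a * cis (2 * alpha) * z / (1 + a) - 1 / 2 * cis (3 * alpha) * z ^ 2)
              / (1 - cis alpha * z) ^ 2).

(* Main.v *)
Require Import Defs.
From Stdlib Require Import Ranalysis5 Lra Lia Psatz.

(* Put c = (1 - a) / (1 + a), u = e^{i alpha} z, w = (1 + u) / (1 - u) and let L = log w.
   The dilatation determines f: h and g are combinations of z/(1-z), z/(1-z)^2 and L.
   Up to constants, the slanted factor acts on power series as phi |-> phi(u) +/- c u phi'(u), so
   e^{i alpha} (f_{a,alpha} * f)(z) = Re S + i Im T with
     16 S = c^2 w^3 + (5 - c^2) w - 1/w - 4,   16 T = 2 L / c + 3 c (w^2 - 1).
   Here w runs over the right half-plane; in the polar coordinates c w = rho e^{it},
     16 c Re S + 4 c = xi = rho^3 cos 3t + (5 - c^2) rho cos t - c^2 cos t / rho,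
     16 c Im T = eta = 2 t + 3 rho^2 sin 2t.
   On a level set eta = y > 0 the variable rho is a function of t, defined on an interval,
   and d xi / dt is minus the Jacobian of (xi, eta) divided by d eta / d rho, hence negative.
   So xi is injective on the level set and its range there is an interval; the case y < 0
   follows by symmetry and y = 0 is the positive axis. *)

(** * Complex derivatives *)

Definition is_cderive (f : C -> C) (z l : C) : Prop :=
  is_derive (K := C_AbsRing) (V := C_NormedModule) f z l.

Lemma is_cderive_eps (f : C -> C) (z l : C) :
  is_cderive f z l <->
  forall eps : posreal, exists delta : posreal, forall w : C,
    (Cmod (w - z) < delta)%R ->
    (Cmod (f w - f z - (w - z) * l) <= eps * Cmod (w - z))%R.
Proof.
split.
- intros [_ H] eps.
  assert (Hl : is_filter_lim (locally (z : AbsRing_UniformSpace C_AbsRing)) z) by (intros P HP; exact HP).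
  destruct (H z Hl eps) as [d Hd].
  exists d; intros w Hw.
  exact (Hd w Hw).
- intros H. split.
  + apply is_linear_scal_l.
  + intros x Hx eps.
    rewrite <- (is_filter_lim_locally_unique (V := AbsRing_NormedModule C_AbsRing) z x Hx).
    destruct (H eps) as [d Hd]. exists d. intros w Hw. exact (Hd w Hw).
Qed.

(** The product rule, and the inner function of the chain rule, live in [AbsRing_NormedModule],
    while [analytic] uses [C_NormedModule]. Both norms are [Cmod], so both notions of derivative
    have the same epsilon form. *)
Lemma is_cderive_AbsRing (f : C -> C) (z l : C) :
  is_cderive f z l <->
  is_derive (K := C_AbsRing) (V := AbsRing_NormedModule C_AbsRing) f z l.
Proof.
rewrite is_cderive_eps. split.
- intros H. split.
  + apply is_linear_scal_l.
  + intros x Hx eps.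
    rewrite <- (is_filter_lim_locally_unique (V := AbsRing_NormedModule C_AbsRing) z x Hx).
    destruct (H eps) as [d Hd]. exists d. intros w Hw. exact (Hd w Hw).
- intros [_ H] eps.
  assert (Hl : is_filter_lim (locally (z : AbsRing_UniformSpace C_AbsRing)) z) by (intros P HP; exact HP).
  destruct (H z Hl eps) as [d Hd].
  exists d; intros w Hw.
  exact (Hd w Hw).
Qed.

Lemma is_cderive_const (k z : C) : is_cderive (fun _ => k) z 0.
Proof. exact (is_derive_const (K := C_AbsRing) (V := C_NormedModule) k z). Qed.

Lemma is_cderive_id (z : C) : is_cderive (fun w => w) z 1.
Proof. apply is_cderive_AbsRing. exact (is_derive_id (K := C_AbsRing) z). Qed.

Lemma is_cderive_plus (f g : C -> C) (z l m : C) :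
  is_cderive f z l -> is_cderive g z m -> is_cderive (fun w => f w + g w) z (l + m).
Proof. exact (is_derive_plus f g z l m). Qed.

Lemma is_cderive_minus (f g : C -> C) (z l m : C) :
  is_cderive f z l -> is_cderive g z m -> is_cderive (fun w => f w - g w) z (l - m).
Proof. exact (is_derive_minus f g z l m). Qed.

Lemma is_cderive_mult (f g : C -> C) (z l m : C) :
  is_cderive f z l -> is_cderive g z m ->
  is_cderive (fun w => f w * g w) z (l * g z + f z * m).
Proof.
rewrite !is_cderive_AbsRing; intros Hf Hg.
exact (is_derive_mult (K := C_AbsRing) f g z l m Hf Hg Cmult_comm).
Qed.

Lemma is_cderive_comp (f g : C -> C) (z l m : C) :
  is_cderive f (g z) l -> is_cderive g z m ->
  is_cderive (fun w => f (g w)) z (m * l).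
Proof.
rewrite (is_cderive_AbsRing g); intros Hf Hg.
exact (is_derive_comp (K := C_AbsRing) (V := C_NormedModule) f g z l m Hf Hg).
Qed.

Lemma is_cderive_ext_loc (f g : C -> C) (z l : C) (d : posreal) :
  (forall w, (Cmod (w - z) < d)%R -> f w = g w) ->
  is_cderive f z l -> is_cderive g z l.
Proof.
rewrite !is_cderive_eps; intros Hfg H eps.
destruct (H eps) as [d1 Hd1].
exists (mkposreal _ (Rmin_stable_in_posreal d d1)); simpl; intros w Hw.
assert (Hw1 := Rlt_le_trans _ _ _ Hw (Rmin_l _ _)).
assert (Hw2 := Rlt_le_trans _ _ _ Hw (Rmin_r _ _)).
rewrite <- !Hfg; auto.
replace (z - z) with (RtoC 0) by ring; rewrite Cmod_0; apply cond_pos.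
Qed.

Lemma is_cderive_value (f : C -> C) (z l m : C) :
  is_cderive f z l -> l = m -> is_cderive f z m.
Proof. now intros H <-. Qed.

Lemma is_cderive_Cinv (z : C) : z <> 0 -> is_cderive Cinv z (- / (z * z)).
Proof.
intros Hz; apply is_cderive_eps; intros eps.
assert (Hm : (0 < Cmod z)%R) by now apply Cmod_gt_0.
(* The first bound keeps |w| >= |z|/2; with the second, the error |w - z|^2 / (|w| |z|^2) is then at
   most eps |w - z|. *)
assert (Hd : (0 < Rmin (Cmod z / 2) (eps * (Cmod z * Cmod z * Cmod z) / 2))%R).
{ assert (He := cond_pos eps).
  apply Rmin_pos; [lra|].
  apply Rdiv_lt_0_compat; [|lra]; repeat apply Rmult_lt_0_compat; assumption. }
exists (mkposreal _ Hd); simpl; intros w Hw.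
assert (Hw1 := Rlt_le_trans _ _ _ Hw (Rmin_l _ _)).
assert (Hw2 := Rlt_le_trans _ _ _ Hw (Rmin_r _ _)).
assert (Hwm : (Cmod z / 2 <= Cmod w)%R).
{ assert (H := Cmod_triangle (z - w) w).
  replace (z - w + w) with z in H by ring.
  replace (z - w) with (- (w - z)) in H by ring. rewrite Cmod_opp in H. lra. }
assert (Hw0 : w <> 0) by (apply Cmod_gt_0; lra).
replace (/ w - / z - (w - z) * - / (z * z)) with ((w - z) * (w - z) * / (w * (z * z)))
  by (field; split; assumption).
rewrite !Cmod_mult, Cmod_inv, !Cmod_mult by (repeat apply Cmult_neq_0; assumption).
rewrite (Rmult_comm eps), Rmult_assoc.
apply Rmult_le_compat_l; [apply Cmod_ge_0|].
apply (Rmult_le_reg_r (Cmod w * (Cmod z * Cmod z))).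
{ repeat apply Rmult_lt_0_compat; lra. }
rewrite Rmult_assoc, Rinv_l by (apply Rgt_not_eq; repeat apply Rmult_lt_0_compat; lra).
assert (He := cond_pos eps).
assert (0 <= eps * (Cmod z * Cmod z) * (Cmod w - Cmod z / 2))%R by (repeat apply Rmult_le_pos; lra).
lra.
Qed.

Lemma is_cderive_inv (f : C -> C) (z l : C) :
  f z <> 0 -> is_cderive f z l ->
  is_cderive (fun w => / f w) z (- l / (f z * f z)).
Proof.
intros Hz Hf.
apply is_cderive_value with (l * - / (f z * f z)).
- now apply (is_cderive_comp Cinv f); [apply is_cderive_Cinv|].
- field; assumption.
Qed.

Lemma is_cderive_scal (k : C) (f : C -> C) (z l : C) :
  is_cderive f z l -> is_cderive (fun w => k * f w) z (k * l).
Proof.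
intros H; apply is_cderive_value with (0 * f z + k * l); [|ring].
apply (is_cderive_mult (fun _ => k)); [apply is_cderive_const|exact H].
Qed.

Lemma disk_open (z : C) : disk z ->
  exists d : posreal, forall w, (Cmod (w - z) < d)%R -> disk w.
Proof.
unfold disk; intros Hz.
assert (Hd : (0 < 1 - Cmod z)%R) by lra.
exists (mkposreal _ Hd); simpl; intros w Hw.
assert (H := Cmod_triangle (w - z) z).
replace (w - z + z) with w in H by ring. lra.
Qed.

Lemma is_cderive_ext_disk (f g : C -> C) (z l : C) :
  disk z -> (forall w, disk w -> f w = g w) ->
  is_cderive f z l -> is_cderive g z l.
Proof.
intros Hz Hfg; destruct (disk_open z Hz) as [d Hd].
apply is_cderive_ext_loc with d; auto.
Qed.

(** Along s |-> s z the function f has derivative z l, and every real-linear p with |p w| <= |w|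
    passes through the difference quotient; Re and Im are two such p. This makes real one-variable
    calculus available on rays. *)
Lemma is_cderive_along_ray (f : C -> C) (z l : C) (t : R) :
  is_cderive f (t * z) l ->
  is_derive (fun s : R => Re (f (s * z))) t (Re (z * l)) /\
  is_derive (fun s : R => Im (f (s * z))) t (Im (z * l)).
Proof.
intros H.
assert (Hrat : forall p : C -> R, (forall w, Rabs (p w) <= Cmod w)%R ->
  (forall v w : C, p (v - w) = (p v - p w)%R) -> (forall (r : R) (w : C), p (r * w) = (r * p w)%R) ->
  is_derive (fun s : R => p (f (s * z))) t (p (z * l))).
{ intros p Hp Hm Hs. split; [apply is_linear_scal_l|].
  intros x Hx eps.
  rewrite <- (is_filter_lim_locally_unique (V := AbsRing_NormedModule R_AbsRing) t x Hx).
  rewrite is_cderive_eps in H.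
  (* [Cmod z + 1] serves as divisor because z may be 0. *)
  assert (Hz : (0 < Cmod z + 1)%R) by (assert (h := Cmod_ge_0 z); lra).
  assert (He : (0 < eps / (Cmod z + 1))%R) by (apply Rdiv_lt_0_compat; [apply cond_pos|assumption]).
  destruct (H (mkposreal _ He)) as [d Hd].
  assert (Hd' : (0 < d / (Cmod z + 1))%R) by (apply Rdiv_lt_0_compat; [apply cond_pos|assumption]).
  exists (mkposreal _ Hd'). intros s Hst.
  change (Rabs (s - t) < d / (Cmod z + 1))%R in Hst.
  change (Rabs (p (f ((s : R) * z)%C) - p (f (t * z)%C) - (s - t) * p (z * l)%C) <= eps * Rabs (s - t))%R.
  rewrite <- Hs, <- !Hm.
  replace (f (s * z) - f (t * z) - (s - t)%R * (z * l))
    with (f (s * z) - f (t * z) - (s * z - t * z) * l) by (rewrite RtoC_minus; ring).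
  eapply Rle_trans; [apply Hp|].
  assert (Hdist : Cmod (s * z - t * z) = (Rabs (s - t) * Cmod z)%R).
  { rewrite <- Cmod_R, <- Cmod_mult, RtoC_minus. f_equal; ring. }
  assert (Hst' : (Rabs (s - t) * (Cmod z + 1) < d)%R).
  { apply (Rmult_lt_compat_r (Cmod z + 1)) in Hst; [|assumption].
    replace (d / (Cmod z + 1) * (Cmod z + 1))%R with (d : R) in Hst by (field; lra). assumption. }
  assert (Ha := Rabs_pos (s - t)). assert (Hz0 := Cmod_ge_0 z).
  eapply Rle_trans; [apply Hd; rewrite Hdist; lra|].
  rewrite Hdist. simpl.
  apply Rle_trans with (eps / (Cmod z + 1) * (Rabs (s - t) * (Cmod z + 1)))%R.
  - apply Rmult_le_compat_l; lra.
  - right; field; lra. }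
split.
- apply (Hrat Re).
  + apply re_le_Cmod.
  + intros v w; destruct v, w; cbn; ring.
  + intros r w; destruct w; cbn; ring.
- apply (Hrat Im).
  + intros w. eapply Rle_trans; [|apply Rmax_Cmod]. apply Rmax_r.
  + intros v w; destruct v, w; cbn; ring.
  + intros r w; destruct w; cbn; ring.
Qed.

(** * Complex power series *)

Definition is_cseries (a : nat -> C) (l : C) : Prop :=
  is_series (K := C_AbsRing) (V := C_NormedModule) a l.

Definition csum (a : nat -> C) (n : nat) : C :=
  sum_n (G := C_AbelianMonoid) a n.

Lemma csum_O (a : nat -> C) : csum a 0 = a 0%nat.
Proof. apply sum_O. Qed.

Lemma csum_S (a : nat -> C) (n : nat) : csum a (S n) = csum a n + a (S n).
Proof. apply (sum_Sn (G := C_AbelianMonoid)). Qed.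

Lemma is_cseries_of_bound (a : nat -> C) (l : C) (e : nat -> R) :
  is_lim_seq e 0 -> (forall n, Cmod (csum a n - l) <= e n)%R -> is_cseries a l.
Proof.
intros He H.
apply (filterlim_locally_ball_norm (K := C_AbsRing) (U := C_NormedModule)); intros eps.
apply is_lim_seq_spec in He; destruct (He eps) as [N HN].
exists N; intros n Hn.
change (Cmod (csum a n - l) < eps)%R.
specialize (HN n Hn). rewrite Rminus_0_r in HN.
apply Rabs_def2 in HN. eapply Rle_lt_trans; [apply H|lra].
Qed.

Lemma is_cseries_unique (a : nat -> C) (l m : C) :
  is_cseries a l -> is_cseries a m -> l = m.
Proof. apply (filterlim_locally_unique (K := C_AbsRing) (V := C_NormedModule)). Qed.

Lemma is_cseries_ext (a b : nat -> C) (l : C) :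
  (forall n, a n = b n) -> is_cseries a l -> is_cseries b l.
Proof. apply is_series_ext. Qed.

Lemma is_cseries_plus (a b : nat -> C) (l m : C) :
  is_cseries a l -> is_cseries b m -> is_cseries (fun n => a n + b n) (l + m).
Proof. apply (is_series_plus a b l m). Qed.

Lemma is_cseries_scal (k : C) (a : nat -> C) (l : C) :
  is_cseries a l -> is_cseries (fun n => k * a n) (k * l).
Proof. apply (is_series_scal (V := C_NormedModule) k a l). Qed.

Lemma pow_n_Cpow (z : C) (n : nat) : pow_n (K := C_AbsRing) z n = z ^ n.
Proof.
induction n as [|n IH]; [reflexivity|].
change (z * pow_n (K := C_AbsRing) z n = z ^ S n). now rewrite IH, Cpow_S.
Qed.

Definition is_cpseries (a : nat -> C) (z l : C) : Prop :=
  is_pseries (K := C_AbsRing) (V := C_NormedModule) a z l.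

Lemma is_cpseries_cseries (a : nat -> C) (z l : C) :
  is_cpseries a z l <-> is_cseries (fun n => a n * z ^ n) l.
Proof.
split; apply is_cseries_ext; intros n.
- change (pow_n (K := C_AbsRing) z n * a n = a n * z ^ n). rewrite pow_n_Cpow; ring.
- change (a n * z ^ n = pow_n (K := C_AbsRing) z n * a n). now rewrite (Cmult_comm _ (a n)).
Qed.

Lemma CPSeries_unique (a : nat -> C) (z l : C) :
  is_cpseries a z l -> CPSeries a z = l.
Proof.
intros H; apply (iota_unique (V := C_CompleteNormedModule)); [|exact H].
intros m Hm; exact (is_cseries_unique _ _ _ Hm H).
Qed.

Lemma is_cseries_Re_Im (a : nat -> C) (l : C) :
  is_cseries a l -> is_series (fun n => Re (a n)) (Re l) /\ is_series (fun n => Im (a n)) (Im l).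
Proof.
intros H; split.
- apply filterlim_ext with (fun n => Re (csum a n)).
  { induction x as [|n IH]; [now rewrite csum_O, sum_O|].
    rewrite csum_S, sum_Sn, <- IH. reflexivity. }
  apply (filterlim_comp _ _ _ (csum a) Re _ _ _ H).
  apply (filterlim_locally (U := R_UniformSpace)); intros eps.
  exists eps; intros y Hy; apply Hy.
- apply filterlim_ext with (fun n => Im (csum a n)).
  { induction x as [|n IH]; [now rewrite csum_O, sum_O|].
    rewrite csum_S, sum_Sn, <- IH. reflexivity. }
  apply (filterlim_comp _ _ _ (csum a) Im _ _ _ H).
  apply (filterlim_locally (U := R_UniformSpace)); intros eps.
  exists eps; intros y Hy; apply Hy.
Qed.

(** Convergence at 1/2 makes both radii positive, and sums that agree near 0 have equal
    coefficients. *)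
Lemma pseries_coeff_unique (a b : nat -> R) :
  (forall x : R, (Rabs x < 1)%R -> exists l, is_pseries a x l /\ is_pseries b x l) ->
  forall n, a n = b n.
Proof.
intros H n.
assert (Hhalf : (Rabs (/ 2) < 1)%R) by (rewrite Rabs_pos_eq; lra).
assert (Hcv : forall c : nat -> R, ex_pseries c (/ 2)%R -> Rbar_lt 0 (CV_radius c)).
{ intros c Hc.
  apply Rbar_lt_le_trans with (Rabs (/ 2)%R); [rewrite Rabs_pos_eq; simpl; lra|].
  apply Rbar_not_lt_le; intros Hlt.
  apply CV_disk_outside in Hlt. apply Hlt.
  apply ex_series_lim_0.
  apply ex_series_ext with (2 := Hc); intros k.
  change (scal (pow_n (K := R_AbsRing) (/ 2)%R k) (c k)) with (pow_n (K := R_AbsRing) (/ 2)%R k * c k)%R.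
  rewrite pow_n_pow. apply Rmult_comm. }
destruct (H (/ 2)%R Hhalf) as [l [Ha Hb]].
apply PSeries_ext_recip.
- apply Hcv; now exists l.
- apply Hcv; now exists l.
- exists (mkposreal 1 Rlt_0_1); intros x Hx.
  change (Rabs (x - 0) < 1)%R in Hx; rewrite Rminus_0_r in Hx.
  destruct (H x Hx) as [m [Hma Hmb]].
  now rewrite (is_pseries_unique _ _ _ Hma), (is_pseries_unique _ _ _ Hmb).
Qed.

(** At real points the series splits into its real and imaginary parts, and the real case applies to
    each. *)
Lemma cpseries_coeff_unique (a b : nat -> C) :
  (forall z, disk z -> exists l, is_cpseries a z l /\ is_cpseries b z l) ->
  forall n, a n = b n.
Proof.
intros H n.
assert (Hreal : forall (c : nat -> C) (x : R) l, is_cpseries c x l ->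
  is_pseries (fun k => Re (c k)) x (Re l) /\ is_pseries (fun k => Im (c k)) x (Im l)).
{ intros c x l Hc. apply is_cpseries_cseries, is_cseries_Re_Im in Hc.
  destruct Hc as [H1 H2]. rewrite !is_pseries_R; split.
  - apply is_series_ext with (2 := H1); intros k.
    now rewrite <- RtoC_pow, re_scal_r.
  - apply is_series_ext with (2 := H2); intros k.
    rewrite <- RtoC_pow. destruct (c k); cbn; ring. }
apply injective_projections.
- apply (pseries_coeff_unique (fun k => Re (a k)) (fun k => Re (b k))); intros x Hx.
  destruct (H x) as [l [Ha Hb]]; [unfold disk; now rewrite Cmod_R|].
  exists (Re l); split; now apply Hreal.
- apply (pseries_coeff_unique (fun k => Im (a k)) (fun k => Im (b k))); intros x Hx.
  destruct (H x) as [l [Ha Hb]]; [unfold disk; now rewrite Cmod_R|].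
  exists (Im l); split; now apply Hreal.
Qed.

(** The choice in [taylor] is over a nonempty set, as [a] belongs to it; uniqueness of coefficients
    identifies the chosen sequence with [a]. *)
Lemma taylor_unique (phi : C -> C) (a : nat -> C) :
  (forall z, disk z -> is_cpseries a z (phi z)) -> forall n, taylor phi n = a n.
Proof.
intros H; apply cpseries_coeff_unique; intros z Hz.
exists (phi z); split; [|now apply H].
revert z Hz. unfold taylor; apply epsilon_spec; now exists a.
Qed.

Lemma hadamard_pseries (phi psi : C -> C) (a b : nat -> C) (z l : C) :
  (forall w, disk w -> is_cpseries a w (phi w)) ->
  (forall w, disk w -> is_cpseries b w (psi w)) ->
  is_cseries (fun n => a n * b n * z ^ n) l -> hadamard phi psi z = l.
Proof.
intros Ha Hb H; apply CPSeries_unique, is_cpseries_cseries.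
apply is_cseries_ext with (2 := H); intros n.
now rewrite (taylor_unique phi a Ha), (taylor_unique psi b Hb).
Qed.

(** * Geometric and logarithmic series *)

(** These are the terms of the twice differentiated geometric series, which converges for r < 1. *)
Lemma is_lim_seq_sqr_geom (r : R) : (0 <= r < 1)%R ->
  is_lim_seq (fun n => (INR n + 1) * (INR n + 2) * r ^ n)%R 0.
Proof.
intros Hr. apply ex_series_lim_0.
assert (Hcv : CV_radius (fun _ => 1%R) = Finite 1).
{ rewrite (CV_radius_finite_DAlembert _ 1); [f_equal; lra|intros; lra|lra|].
  apply is_lim_seq_ext with (fun _ => 1%R); [|apply is_lim_seq_const].
  intros n; rewrite Rdiv_1_r, Rabs_R1; reflexivity. }
assert (H : ex_pseries (PS_derive (PS_derive (fun _ => 1%R))) r).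
{ apply CV_disk_correct, CV_disk_inside.
  rewrite !CV_radius_derive, Hcv. simpl. rewrite Rabs_pos_eq; lra. }
apply ex_series_ext with (2 := H); intros n.
change (pow_n (K := R_AbsRing) r n * (INR (S n) * (INR (S (S n)) * 1)) =
  (INR n + 1) * (INR n + 2) * r ^ n)%R.
rewrite pow_n_pow, !S_INR; ring.
Qed.

Lemma disk_one_minus (z : C) : disk z -> 1 - z <> 0.
Proof.
intros Hz H. unfold disk in Hz.
replace z with (1 : C) in Hz by (rewrite <- (Cplus_0_l z), <- H; ring).
rewrite Cmod_1 in Hz; lra.
Qed.

Lemma disk_opp (z : C) : disk z -> disk (- z).
Proof. unfold disk; now rewrite Cmod_opp. Qed.

Lemma disk_one_plus (z : C) : disk z -> 1 + z <> 0.
Proof.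
intros Hz. replace (1 + z) with (1 - - z) by ring. now apply disk_one_minus, disk_opp.
Qed.

(** [z ^ n * q n] is the error of the n-th partial sum, by induction from the two identities.
    Quadratic growth of [q] cannot stop it from tending to 0. Each series with a rational sum below
    only has to exhibit its [q]. *)
Lemma is_cseries_of_tail (a q : nat -> C) (z l : C) (K : R) :
  disk z -> a 0%nat - l = q 0%nat ->
  (forall n, z ^ n * q n + a (S n) = z ^ S n * q (S n)) ->
  (forall n, Cmod (q n) <= K * ((INR n + 1) * (INR n + 2)))%R -> is_cseries a l.
Proof.
intros Hz Ha0 HaS Hq.
assert (Ha : forall n, csum a n - l = z ^ n * q n).
{ induction n as [|n IH]; [rewrite csum_O, Ha0; simpl; ring|].
  rewrite csum_S, <- HaS, <- IH; ring. }
apply is_cseries_of_bound with (fun n => K * ((INR n + 1) * (INR n + 2) * Cmod z ^ n))%R.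
- replace (Finite 0) with (Rbar_mult K 0) by (simpl; f_equal; ring).
  apply is_lim_seq_scal_l, is_lim_seq_sqr_geom; split; [apply Cmod_ge_0|exact Hz].
- intros n; rewrite Ha, Cmod_mult, Cmod_pow.
  rewrite (Rmult_comm (_ ^ n)), <- Rmult_assoc.
  apply Rmult_le_compat_r; [apply pow_le, Cmod_ge_0|apply Hq].
Qed.

Lemma geom_series (z : C) : disk z -> is_cseries (fun n => z ^ n) (/ (1 - z)).
Proof.
intros Hz. assert (H1 := disk_one_minus z Hz).
apply is_cseries_of_tail with (q := fun _ => - z / (1 - z)) (z := z) (K := Cmod (- z / (1 - z))); auto.
- simpl; field; assumption.
- intros n; rewrite !Cpow_S; field; assumption.
- intros n. assert (Hn := pos_INR n). rewrite <- (Rmult_1_r (Cmod _)) at 1.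
  apply Rmult_le_compat_l; [apply Cmod_ge_0|nra].
Qed.

Lemma arith_geom_series (z : C) : disk z -> is_cseries (fun n => INR n * z ^ n) (z / (1 - z) ^ 2).
Proof.
intros Hz. assert (H1 := disk_one_minus z Hz).
assert (Hm := Cmod_ge_0 (/ (1 - z) ^ 2)).
apply is_cseries_of_tail with (q := fun n => (- z * (INR n + 1) + z * z * INR n) * / (1 - z) ^ 2)
  (z := z) (K := Cmod (/ (1 - z) ^ 2)); auto.
- simpl; field; assumption.
- intros n; rewrite S_INR, RtoC_plus, !Cpow_S; field; assumption.
- intros n. assert (Hn := pos_INR n). rewrite Cmod_mult, Rmult_comm.
  apply Rmult_le_compat_l; [assumption|].
  eapply Rle_trans; [apply Cmod_triangle|].
  rewrite <- RtoC_plus, !Cmod_mult, Cmod_opp, !Cmod_R, !Rabs_pos_eq by lra.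
  unfold disk in Hz. assert (H0 := Cmod_ge_0 z).
  assert (Hm1 : (Cmod z * (INR n + 1) <= 1 * (INR n + 1))%R) by (apply Rmult_le_compat_r; lra).
  assert (Hm2 : (Cmod z * Cmod z * INR n <= 1 * INR n)%R) by (apply Rmult_le_compat_r; nra).
  nra.
Qed.

Lemma square_geom_series (z : C) : disk z ->
  is_cseries (fun n => INR n ^ 2 * z ^ n) (z * (1 + z) / (1 - z) ^ 3).
Proof.
intros Hz. assert (H1 := disk_one_minus z Hz).
assert (Hm := Cmod_ge_0 (/ (1 - z) ^ 3)).
(* Minus the tail of the series after index n, divided by z^n; its leading term is -(n + 1)^2 z. *)
set (q := fun n : nat => (- z * (INR n + 1) ^ 2 + z ^ 2 * (2 * INR n ^ 2 + 2 * INR n - 1) - z ^ 3 * INR n ^ 2) * / (1 - z) ^ 3).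
apply is_cseries_of_tail with (q := q) (z := z) (K := (4 * Cmod (/ (1 - z) ^ 3))%R); auto.
- unfold q; simpl; field; assumption.
- intros n; unfold q; rewrite S_INR, RtoC_plus, !Cpow_S; field; assumption.
- intros n. assert (Hn := pos_INR n). unfold q. rewrite Cmod_mult, (Rmult_comm 4), Rmult_assoc, Rmult_comm.
  apply Rmult_le_compat_l; [assumption|].
  eapply Rle_trans; [apply Cmod_triangle|].
  eapply Rle_trans; [apply Rplus_le_compat_r, Cmod_triangle|].
  replace (2 * INR n ^ 2 + 2 * INR n - 1) with (RtoC (2 * INR n ^ 2 + 2 * INR n - 1))
    by (rewrite RtoC_minus, RtoC_plus, !RtoC_mult, RtoC_pow; reflexivity).
  rewrite Cmod_opp, <- RtoC_plus, <- !RtoC_pow, !Cmod_mult, !Cmod_pow, Cmod_opp, !Cmod_R.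
  unfold disk in Hz. assert (H0 := Cmod_ge_0 z). set (m := Cmod z) in *. set (x := INR n) in *.
  rewrite (Rabs_pos_eq ((x + 1) ^ 2)), (Rabs_pos_eq (x ^ 2)) by nra.
  assert (Hab : (Rabs (2 * x ^ 2 + 2 * x - 1) <= 2 * x ^ 2 + 2 * x + 1)%R) by (apply Rabs_le; nra).
  assert (Ha := Rabs_pos (2 * x ^ 2 + 2 * x - 1)).
  assert (m ^ 2 <= 1)%R by nra. assert (m ^ 3 <= 1)%R by nra.
  assert (0 <= m ^ 2)%R by nra. assert (0 <= m ^ 3)%R by (apply pow_le; lra).
  nra.
Qed.

Lemma Cmod_le_Re_Im (z : C) : (Cmod z <= Rabs (Re z) + Rabs (Im z))%R.
Proof.
replace z with (RtoC (Re z) + RtoC (Im z) * Ci) at 1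
  by (destruct z; apply injective_projections; cbn; ring).
eapply Rle_trans; [apply Cmod_triangle|].
rewrite Cmod_mult, !Cmod_R, Cmod_Ci. lra.
Qed.

(** The real mean value inequality is applied to Re f and Im f along the ray through z; adding the
    two bounds gives the factor 2. *)
Lemma cderive_mean_value (f df : C -> C) (z : C) (M : R) :
  (forall t : R, (Rabs t <= 1)%R -> is_cderive f (t * z) (df (t * z)) /\ (Cmod (z * df (t * z)%C) <= M)%R) ->
  (Cmod (f z - f 0) <= 2 * M)%R.
Proof.
intros H.
assert (Hre : (Rabs (Re (f z) - Re (f 0)) <= M * Rabs (1 - 0))%R).
{ replace (Re (f z)) with (Re (f (1%R * z))) by (f_equal; f_equal; ring).
  replace (Re (f 0)) with (Re (f (0%R * z))) by (f_equal; f_equal; ring).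
  apply (bounded_variation (fun t => Re (f (t * z))) (fun t => Re (z * df (t * z)))).
  intros t; rewrite !Rminus_0_r, Rabs_R1; intros Ht.
  destruct (H t Ht) as [H1 H2]; split; [now apply is_cderive_along_ray|].
  eapply Rle_trans; [apply re_le_Cmod|exact H2]. }
assert (Him : (Rabs (Im (f z) - Im (f 0)) <= M * Rabs (1 - 0))%R).
{ replace (Im (f z)) with (Im (f (1%R * z))) by (f_equal; f_equal; ring).
  replace (Im (f 0)) with (Im (f (0%R * z))) by (f_equal; f_equal; ring).
  apply (bounded_variation (fun t => Im (f (t * z))) (fun t => Im (z * df (t * z)))).
  intros t; rewrite !Rminus_0_r, Rabs_R1; intros Ht.
  destruct (H t Ht) as [H1 H2]; split; [now apply is_cderive_along_ray|].
  eapply Rle_trans; [|exact H2].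
  eapply Rle_trans; [|apply Rmax_Cmod]; apply Rmax_r. }
rewrite Rminus_0_r, Rabs_R1, Rmult_1_r in Hre, Him.
eapply Rle_trans; [apply Cmod_le_Re_Im|].
exact (Rle_trans _ _ _ (Rplus_le_compat _ _ _ _ Hre Him) (Req_le _ _ (Rplus_diag M))).
Qed.

(* At [n = 0] the numerator vanishes, so the value there is [0]. *)
Definition log_coeff (n : nat) : C := (1 - (- 1) ^ n) / INR n.

Lemma log_coeff_mult (n : nat) : INR n * log_coeff n = 1 - (- 1) ^ n.
Proof.
unfold log_coeff; destruct n as [|n]; [simpl; ring|].
field. intros H; apply (not_0_INR (S n)); [discriminate|]. now apply RtoC_inj.
Qed.

Lemma is_cderive_pow (z : C) (n : nat) : is_cderive (fun w => w ^ S n) z (INR (S n) * z ^ n).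
Proof.
induction n as [|n IH].
- apply is_cderive_value with (1 * 1 + z * 0); [|simpl; ring].
  apply (is_cderive_mult (fun w => w) (fun _ => 1)); [apply is_cderive_id|apply is_cderive_const].
- apply is_cderive_value with (1 * z ^ S n + z * (INR (S n) * z ^ n)).
  + apply (is_cderive_mult (fun w => w)); [apply is_cderive_id|exact IH].
  + rewrite (S_INR (S n)), RtoC_plus, Cpow_S; ring.
Qed.

(** Termwise differentiation gives the sum of (1 - (-1)^k) z^(k-1) for k = 1, ..., n: two finite
    geometric sums, with ratios z and -z, whose limits 1/(1 - z) and 1/(1 + z) add up to 2/(1 -
    z^2). *)
Lemma is_cderive_log_csum (z : C) (n : nat) : disk z ->
  is_cderive (fun w => csum (fun k => log_coeff k * w ^ k) n) z
    (2 / (1 - z ^ 2) - z ^ n / (1 - z) - (- z) ^ n / (1 + z)).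
Proof.
intros Hz. assert (H1 := disk_one_minus z Hz). assert (H2 := disk_one_plus z Hz).
assert (H3 : 1 - z ^ 2 <> 0).
{ replace (1 - z ^ 2) with ((1 - z) * (1 + z)) by ring. now apply Cmult_neq_0. }
assert (H4 : 1 - z * z <> 0) by (replace (1 - z * z) with (1 - z ^ 2) by ring; assumption).
induction n as [|n IH].
- apply is_cderive_ext_loc with (fun _ => log_coeff 0) (mkposreal 1 Rlt_0_1).
  { intros w _; rewrite csum_O; simpl; ring. }
  apply is_cderive_value with (RtoC 0); [apply is_cderive_const|].
  simpl. field. repeat split; auto.
- apply is_cderive_ext_loc with (fun w => csum (fun k => log_coeff k * w ^ k) n + log_coeff (S n) * w ^ S n) (mkposreal 1 Rlt_0_1).
  { intros w _; now rewrite csum_S. }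
  eapply is_cderive_value.
  + apply is_cderive_plus; [exact IH|apply is_cderive_scal, is_cderive_pow].
  + rewrite Cmult_assoc, (Cmult_comm (log_coeff _)), log_coeff_mult.
    replace ((- z) ^ S n) with ((- 1) ^ S n * z ^ S n) by (rewrite <- Cpow_mult_l; f_equal; ring).
    replace ((- z) ^ n) with ((- 1) ^ n * z ^ n) by (rewrite <- Cpow_mult_l; f_equal; ring).
    rewrite !Cpow_S. field; repeat split; auto.
Qed.

(** L stands for log((1 + z)/(1 - z)), given by its derivative and its value at 0, so that no branch
    has to be constructed. The error of the n-th partial sum vanishes at 0 and has derivative at
    most 2 |z|^n / (1 - |z|) on the segment to z; the mean value bound then makes it tend to 0. *)
Lemma log_series (L : C -> C) :
  L 0 = 0 -> (forall z, disk z -> is_cderive L z (2 / (1 - z ^ 2))) ->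
  forall z, disk z -> is_cseries (fun n => log_coeff n * z ^ n) (L z).
Proof.
intros L0 HL z Hz.
assert (Hr : (0 < 1 - Cmod z)%R) by (unfold disk in Hz; lra).
assert (H0 := Cmod_ge_0 z).
apply is_cseries_of_bound with (fun n => 4 * / (1 - Cmod z) * ((INR n + 1) * (INR n + 2) * Cmod z ^ n))%R.
{ replace (Finite 0) with (Rbar_mult (4 * / (1 - Cmod z))%R 0) by (simpl; f_equal; apply Rmult_0_r).
  apply is_lim_seq_scal_l, is_lim_seq_sqr_geom; split; [apply Cmod_ge_0|exact Hz]. }
intros n.
assert (Hsum0 : csum (fun k => log_coeff k * 0 ^ k) n = 0).
{ induction n as [|n IH].
  - rewrite csum_O; unfold log_coeff, Cdiv; simpl; ring.
  - rewrite csum_S, IH, Cpow_S; ring. }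
set (E := fun w => csum (fun k => log_coeff k * w ^ k) n - L w).
set (dE := fun w => - (w ^ n / (1 - w)) - (- w) ^ n / (1 + w)).
replace (csum (fun k => log_coeff k * z ^ k) n - L z) with (E z - E 0)
  by (unfold E; rewrite Hsum0, L0; ring).
apply Rle_trans with (2 * (2 * (Cmod z ^ n / (1 - Cmod z))))%R.
- apply (cderive_mean_value E dE); intros t Ht.
  assert (Htz : (Cmod (t * z) <= Cmod z)%R).
  { rewrite Cmod_mult, Cmod_R. nra. }
  assert (Hdz : disk (t * z)) by (unfold disk in *; lra).
  assert (Hbound : forall w, Cmod w = Cmod (t * z) -> (Cmod (w ^ n / (1 - w)) <= Cmod z ^ n / (1 - Cmod z))%R).
  { intros w Hw. unfold Cdiv.
    assert (Hdw : disk w) by (unfold disk in *; lra).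
    assert (Hge : (1 - Cmod z <= Cmod (1 - w))%R).
    { assert (h := Cmod_triangle (1 - w) w). replace (1 - w + w) with (1 : C) in h by ring.
      rewrite Cmod_1 in h; lra. }
    rewrite Cmod_mult, Cmod_inv, Cmod_pow by now apply disk_one_minus.
    apply Rmult_le_compat.
    - apply pow_le, Cmod_ge_0.
    - apply Rlt_le, Rinv_0_lt_compat; lra.
    - apply pow_incr; split; [apply Cmod_ge_0|lra].
    - apply Rinv_le_contravar; lra. }
  split.
  + unfold E, dE. eapply is_cderive_value.
    * apply is_cderive_minus; [now apply is_cderive_log_csum|now apply HL].
    * ring.
  + assert (Hb1 := Hbound (t * z) eq_refl).
    assert (Hb2 := Hbound (- (t * z)) (Cmod_opp _)).
    replace (1 - - (t * z)) with (1 + t * z) in Hb2 by ring.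
    assert (Hd : (Cmod (dE (t * z)%C) <= 2 * (Cmod z ^ n / (1 - Cmod z)))%R).
    { unfold dE. eapply Rle_trans; [apply Cmod_triangle|]. rewrite !Cmod_opp. lra. }
    rewrite Cmod_mult. unfold disk in Hz. assert (h := Cmod_ge_0 (dE (t * z))). nra.
- assert (Hp := pow_le _ n H0). assert (Hn := pos_INR n).
  assert (Hi : (0 < / (1 - Cmod z))%R) by now apply Rinv_0_lt_compat.
  replace (2 * (2 * (Cmod z ^ n / (1 - Cmod z))))%R with (4 * / (1 - Cmod z) * (1 * Cmod z ^ n))%R by (unfold Rdiv; ring).
  apply Rmult_le_compat_l; [lra|]. apply Rmult_le_compat_r; [assumption|nra].
Qed.

(** * The convolution with a slanted mapping *)

(** The coefficients of z / (1 - z), the identity for the convolution of functions vanishing at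
    0. *)
Definition nonconst (n : nat) : C := match n with O => 0 | S _ => 1 end.

Lemma shifted_geom_series (z : C) : disk z -> is_cseries (fun n => nonconst n * z ^ n) (z / (1 - z)).
Proof.
intros Hz. assert (H1 := disk_one_minus z Hz).
apply is_cseries_of_tail with (q := fun _ => - z / (1 - z)) (z := z) (K := Cmod (- z / (1 - z))); auto.
- simpl; field; assumption.
- intros n; simpl; field; assumption.
- intros n. assert (Hn := pos_INR n). rewrite <- (Rmult_1_r (Cmod _)) at 1.
  apply Rmult_le_compat_l; [apply Cmod_ge_0|nra].
Qed.

Lemma cis_neq_0 (t : R) : cis t <> 0.
Proof.
intros H. injection H; intros H1 H2. assert (h := sin2_cos2 t).
rewrite H1, H2 in h. unfold Rsqr in h; lra.
Qed.

Lemma cis_plus (s t : R) : cis (s + t) = cis s * cis t.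
Proof. apply injective_projections; cbn; [apply cos_plus|rewrite sin_plus; ring]. Qed.

Lemma cis_opp (t : R) : cis (- t) = / cis t.
Proof.
assert (H := cis_neq_0 t).
replace (/ cis t) with (cis (- t + t) / cis t); [rewrite cis_plus; field; assumption|].
rewrite Rplus_opp_l. replace (cis 0) with (1 : C); [field; assumption|].
unfold cis; now rewrite cos_0, sin_0.
Qed.

Lemma Cmod_cis (t : R) : Cmod (cis t) = 1%R.
Proof.
unfold Cmod, cis; simpl fst; simpl snd. rewrite <- sqrt_1; f_equal.
rewrite <- (sin2_cos2 t); unfold Rsqr; ring.
Qed.

Lemma disk_cis (t : R) (z : C) : disk z -> disk (cis t * z).
Proof. unfold disk; now rewrite Cmod_mult, Cmod_cis, Rmult_1_l. Qed.

Lemma is_cseries_slanted (e c z k : C) : disk (e * z) ->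
  is_cseries (fun n => k * e ^ n * (nonconst n + c * INR n) * z ^ n)
    (k * (e * z / (1 - e * z) + c * (e * z / (1 - e * z) ^ 2))).
Proof.
intros Hu.
eapply is_cseries_ext; [|apply is_cseries_scal, is_cseries_plus;
  [apply (shifted_geom_series _ Hu)|apply is_cseries_scal, (arith_geom_series _ Hu)]].
intros n; simpl. rewrite Cpow_mult_l; ring.
Qed.

(** The Cayley transform from the disk onto the right half-plane. *)
Definition w_of (z : C) : C := (1 + z) / (1 - z).

(** For the convolution with parts H and G and e = cis alpha, these two are S = e H + G / e and T =
    e H - G / e, in terms of w and of l = log w. *)
Definition conv_sum (c w : C) : C := (c ^ 2 * w ^ 3 + (5 - c ^ 2) * w - / w - 4) / 16.
Definition conv_diff (c l w : C) : C := (2 * l / c + 3 * c * (w ^ 2 - 1)) / 16.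

(** The product of the coefficients expands into multiples of 1, n, n^2, [log_coeff n] and n
    [log_coeff n] = 1 - (-1)^n. The last one is a difference of two geometric series, so every
    summand has a known sum. *)
Lemma is_cseries_conv (e c z k : C) (l : C) :
  c <> 0 -> disk (e * z) ->
  is_cseries (fun n => log_coeff n * (e * z) ^ n) l ->
  is_cseries (fun n => k * e ^ n * (nonconst n + c * INR n) *
      (/ 2 * (nonconst n + c / 2 * INR n + / (4 * c) * log_coeff n)) * z ^ n)
    (k * (conv_sum c (w_of (e * z)) + conv_diff c l (w_of (e * z)))).
Proof.
intros Hc Hu Hl. set (u := e * z) in *.
assert (H1 := disk_one_minus u Hu). assert (H2 := disk_one_plus u Hu).
assert (Hs := is_cseries_scal (k / 2) _ _
 (is_cseries_plus _ _ _ _ (shifted_geom_series u Hu)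
 (is_cseries_plus _ _ _ _ (is_cseries_scal (3 * c / 2) _ _ (arith_geom_series u Hu))
 (is_cseries_plus _ _ _ _ (is_cseries_scal (/ (4 * c)) _ _ Hl)
 (is_cseries_plus _ _ _ _ (is_cseries_scal (c ^ 2 / 2) _ _ (square_geom_series u Hu))
 (is_cseries_plus _ _ _ _ (is_cseries_scal (/ 4) _ _ (geom_series u Hu))
   (is_cseries_scal (- / 4) _ _ (geom_series (- u) (disk_opp u Hu))))))))).
match goal with |- is_cseries _ ?l => match type of Hs with is_cseries _ ?m => replace l with m end end.
- apply is_cseries_ext with (2 := Hs); intros n; cbv beta.
  replace ((- u) ^ n) with ((- 1) ^ n * u ^ n) by (rewrite <- Cpow_mult_l; f_equal; ring).
  assert (Hlog := log_coeff_mult n).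
  assert (Hun : u ^ n = e ^ n * z ^ n) by apply Cpow_mult_l.
  rewrite Hun.
  (* Eliminating (-1)^n leaves a rational identity in n and [log_coeff n]. It is checked apart at n
     = 0, where [nonconst] and [log_coeff] vanish. *)
  replace ((- 1) ^ n) with (1 - INR n * log_coeff n) by (rewrite Hlog; ring).
  destruct n as [|n].
  + replace (log_coeff 0) with (0 : C) by (unfold log_coeff, Cdiv; simpl; ring).
    simpl; field; assumption.
  + simpl nonconst. field; assumption.
- unfold conv_sum, conv_diff, w_of. field.
  repeat split; auto.
Qed.

(** * The map (rho, t) |-> (xi, eta) *)

Open Scope R_scope.

(** Here k is c^2 and rho is c |w|. The trigonometric factors are cos 3t = 4 cos^3 t - 3 cos t and,
    in [eta], 3 sin 2t = 6 sin t cos t, expanded so that identities become polynomial in sin t and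
    cos t. *)
Definition xi (k rho t : R) : R :=
  rho ^ 3 * (4 * cos t ^ 3 - 3 * cos t) + (5 - k) * rho * cos t - k * cos t / rho.
Definition eta (rho t : R) : R := 2 * t + 6 * rho ^ 2 * (sin t * cos t).

(* The cubic in [q] is affine in [k], and at [k = 1] equals [2 (3 q - 1)^2 (q + 1)]. *)
Lemma jacobian_pos (k q s : R) : 0 < k <= 1 -> 0 < q -> 0 < s ->
  0 < 18 * q ^ 3 + (12 - 6 * k) * q ^ 2 + (10 - 20 * k) * q + 2 * k + 24 * s * (q ^ 2 + k * q).
Proof.
intros Hk Hq Hs.
assert (H1 : 0 <= (1 - k) * (18 * q ^ 3 + 12 * q ^ 2 + 10 * q)).
{ assert (0 < q ^ 2) by nra. assert (0 < q ^ 3) by (apply pow_lt; lra).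
  apply Rmult_le_pos; lra. }
assert (H2 : 0 <= k * (2 * (3 * q - 1) ^ 2 * (q + 1))).
{ apply Rmult_le_pos; [lra|]. apply Rmult_le_pos; [|lra].
  apply Rmult_le_pos; [lra|apply pow2_ge_0]. }
assert (H3 : 0 < 24 * s * (q ^ 2 + k * q)) by (apply Rmult_lt_0_compat; nra).
lra.
Qed.

Lemma sin_cos_pos (t : R) : 0 < t < PI / 2 -> 0 < sin t /\ 0 < cos t.
Proof.
intros H; split; [apply sin_gt_0|apply cos_gt_0]; assert (h := PI_RGT_0); lra.
Qed.

(** The positive root rho of eta rho t = y, for 0 < t < PI/2 and 2 t < y. *)
Definition level (y t : R) : R := sqrt ((y - 2 * t) / (6 * (sin t * cos t))).

Lemma level_pos (y t : R) : 0 < t < PI / 2 -> 2 * t < y ->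
  0 < (y - 2 * t) / (6 * (sin t * cos t)).
Proof.
intros Ht Hy; destruct (sin_cos_pos t Ht).
apply Rdiv_lt_0_compat; [lra|]. apply Rmult_lt_0_compat; [lra|]. now apply Rmult_lt_0_compat.
Qed.

Lemma eta_level (y t : R) : 0 < t < PI / 2 -> 2 * t < y -> eta (level y t) t = y.
Proof.
intros Ht Hy; destruct (sin_cos_pos t Ht). unfold eta, level.
rewrite pow2_sqrt by (apply Rlt_le, level_pos; assumption). field. lra.
Qed.

Lemma level_eta (rho t : R) : 0 < rho -> 0 < t < PI / 2 -> level (eta rho t) t = rho.
Proof.
intros Hr Ht; destruct (sin_cos_pos t Ht). unfold level, eta.
replace (_ / _) with (rho ^ 2) by (field; lra).
apply sqrt_pow2; lra.
Qed.

(** The implicit derivative - eta_t / eta_rho, with eta_t = 2 + 6 rho^2 cos 2t and eta_rho = 12 rho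
    sin t cos t. *)
Lemma is_derive_level (y t : R) : 0 < t < PI / 2 -> 2 * t < y ->
  is_derive (level y) t
    (- (2 + 6 * level y t ^ 2 * (cos t ^ 2 - sin t ^ 2)) / (12 * level y t * (sin t * cos t))).
Proof.
intros Ht Hy; destruct (sin_cos_pos t Ht) as [Hs Hc].
assert (Hq := level_pos y t Ht Hy).
assert (Hr : 0 < level y t) by now apply sqrt_lt_R0.
assert (Heta := eta_level y t Ht Hy). unfold eta in Heta.
unfold level at 1. auto_derive.
- split; [nra|]. split; [exact Hq|exact I].
- change (sqrt ((y + - (2 * t)) * / (6 * (sin t * cos t)))) with (level y t).
  replace (y + - (2 * t)) with (6 * level y t ^ 2 * (sin t * cos t)) by lra.
  field. lra.
Qed.

Lemma is_derive_xi_comp (k t dr : R) (r : R -> R) : 0 < r t -> is_derive r t dr ->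
  is_derive (fun s => xi k (r s) s) t
    ((3 * r t ^ 2 * (4 * cos t ^ 3 - 3 * cos t) + (5 - k) * cos t + k * cos t / r t ^ 2) * dr
     + (r t ^ 3 * (3 * sin t - 12 * cos t ^ 2 * sin t) - (5 - k) * r t * sin t + k * sin t / r t)).
Proof.
intros Hr Hd. unfold xi. auto_derive.
- repeat split; try (now exists dr); lra.
- replace (Derive (fun x => r x) t) with dr by (symmetry; apply is_derive_unique, Hd).
  simpl. field. lra.
Qed.

(** The derivative is xi_t - xi_rho eta_t / eta_rho, which is minus the Jacobian over eta_rho. The
    Jacobian equals cos t / rho^2 times the polynomial of [jacobian_pos] at q = rho^2 and s = cos^2
    t. *)
Lemma xi_level_decr (k y t : R) : 0 < k <= 1 -> 0 < t < PI / 2 -> 2 * t < y ->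
  exists d, is_derive (fun s => xi k (level y s) s) t d /\ d < 0.
Proof.
intros Hk Ht Hy.
assert (Hr : 0 < level y t) by now apply sqrt_lt_R0, level_pos.
eexists; split; [apply is_derive_xi_comp; [exact Hr|now apply is_derive_level]|].
destruct (sin_cos_pos t Ht) as [Hs Hc].
set (r := level y t) in *.
assert (Hsc : sin t ^ 2 = 1 - cos t ^ 2) by (assert (h := sin2_cos2 t); unfold Rsqr in h; lra).
set (s := sin t) in *; set (c := cos t) in *.
assert (Hj := jacobian_pos k (r ^ 2) (c ^ 2) Hk (pow_lt _ 2 Hr) (pow_lt _ 2 Hc)).
match goal with |- ?e < 0 =>
  replace e with (- ((18 * (r ^ 2) ^ 3 + (12 - 6 * k) * (r ^ 2) ^ 2 + (10 - 20 * k) * r ^ 2 + 2 * k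
     + 24 * c ^ 2 * ((r ^ 2) ^ 2 + k * r ^ 2)) * / (12 * r ^ 3 * s))) end.
- assert (0 < / (12 * r ^ 3 * s)).
  { apply Rinv_0_lt_compat. assert (0 < r ^ 3) by now apply pow_lt. nra. }
  nra.
- field_simplify_eq; [|lra].
  replace (s ^ 4) with ((s ^ 2) ^ 2) by ring. rewrite ?Hsc.
  ring.
Qed.

(** * Injectivity and intervals of values of xi on the level sets of eta *)

Lemma intermediate_value (g : R -> R) (p q v : R) : p <= q ->
  (forall s, p <= s <= q -> continuity_pt g s) ->
  g p <= v <= g q \/ g q <= v <= g p -> exists s, p <= s <= q /\ g s = v.
Proof.
intros Hpq Hg.
assert (Hup : forall f, (forall s, p <= s <= q -> continuity_pt f s) ->
  f p <= 0 <= f q -> exists s, p <= s <= q /\ f s = 0).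
{ intros f Hf Hv.
  (* [IVT_interv] asks for strict signs at the ends, so zeros at p or q are taken first. *)
  destruct (Req_dec (f p) 0) as [H|H]; [exists p; split; [lra|exact H]|].
  destruct (Req_dec (f q) 0) as [H'|H']; [exists q; split; [lra|exact H']|].
  assert (Hlt : p < q) by (destruct Hpq as [h|h]; [exact h|subst; lra]).
  destruct (IVT_interv f p q Hf Hlt) as [s Hs]; [lra|lra|now exists s]. }
intros [Hv|Hv].
- destruct (Hup (fun s => g s - v)) as [s [Hs Hs']]; [|lra|exists s; split; [exact Hs|lra]].
  intros s Hs; apply continuity_pt_minus; [now apply Hg|apply continuity_pt_const; now intros ? ?].
- destruct (Hup (fun s => v - g s)) as [s [Hs Hs']]; [|lra|exists s; split; [exact Hs|lra]].
  intros s Hs; apply continuity_pt_minus; [apply continuity_pt_const; now intros ? ?|now apply Hg].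
Qed.

Lemma is_derive_continuity_pt (g : R -> R) (s d : R) : is_derive g s d -> continuity_pt g s.
Proof.
intros H; apply continuity_pt_filterlim, (ex_derive_continuous (V := R_NormedModule)); now exists d.
Qed.

Lemma derive_neg_decr (g : R -> R) (p q : R) : p < q ->
  (forall s, p <= s <= q -> exists d, is_derive g s d /\ d < 0) -> g q < g p.
Proof.
intros Hpq H.
assert (HD : forall s, p <= s <= q -> is_derive g s (Derive g s) /\ Derive g s < 0).
{ intros s Hs; destruct (H s Hs) as [d [Hd Hneg]].
  rewrite (is_derive_unique _ _ _ Hd); now split. }
destruct (MVT_gen g p q (Derive g)) as [s [Hs Heq]].
- rewrite Rmin_left, Rmax_right by lra; intros s Hs; apply HD; lra.
- rewrite Rmin_left, Rmax_right by lra; intros s Hs; eapply is_derive_continuity_pt, HD; lra.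
- rewrite Rmin_left, Rmax_right in Hs by lra.
  destruct (HD s Hs) as [_ Hneg]. nra.
Qed.

Lemma eta_gt (rho t : R) : 0 < rho -> 0 < t < PI / 2 -> 2 * t < eta rho t.
Proof.
intros Hr Ht; destruct (sin_cos_pos t Ht). unfold eta.
assert (0 < rho ^ 2) by now apply pow_lt.
assert (0 < sin t * cos t) by now apply Rmult_lt_0_compat. nra.
Qed.

Lemma eta_opp (rho t : R) : eta rho (- t) = - eta rho t.
Proof. unfold eta; rewrite sin_neg, cos_neg; ring. Qed.

Lemma xi_opp (k rho t : R) : xi k rho (- t) = xi k rho t.
Proof. unfold xi; now rewrite cos_neg. Qed.

Lemma eta_0 (rho : R) : eta rho 0 = 0.
Proof. unfold eta; rewrite sin_0; ring. Qed.

Lemma xi_level_lt (k y s t : R) : 0 < k <= 1 -> 0 < s -> s < t -> t < PI / 2 -> 2 * t < y ->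
  xi k (level y t) t < xi k (level y s) s.
Proof.
intros Hk Hs Hst Ht Hy.
apply (derive_neg_decr (fun r => xi k (level y r) r)); [exact Hst|].
intros r Hr; apply xi_level_decr; lra.
Qed.

(** For t = 0 the map is rho^3 + (5 - k) rho - k / rho, a sum of increasing terms. *)
Lemma xi_0_incr (k r s : R) : 0 < k <= 1 -> 0 < r < s -> xi k r 0 < xi k s 0.
Proof.
intros Hk Hrs; unfold xi; rewrite cos_0.
assert (H1 : k / s < k / r).
{ apply Rmult_lt_compat_l; [lra|]. apply Rinv_lt_contravar; [nra|lra]. }
assert (H2 : r ^ 3 < s ^ 3).
{ assert (0 < (s - r) * (s ^ 2 + s * r + r ^ 2)) by (apply Rmult_lt_0_compat; nra). nra. }
assert (H3 : (5 - k) * r < (5 - k) * s) by (apply Rmult_lt_compat_l; lra).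
replace (4 * 1 ^ 3 - 3 * 1) with 1 by ring.
replace (k * 1 / r) with (k / r) by (unfold Rdiv; ring).
replace (k * 1 / s) with (k / s) by (unfold Rdiv; ring).
lra.
Qed.

(** Both points lie on the curve rho = [level y t], along which xi strictly decreases in t; hence
    the angles agree, and then the radii. *)
Lemma xi_eta_inj_pos (k r s p t : R) : 0 < k <= 1 -> 0 < r -> 0 < s ->
  0 < p < PI / 2 -> 0 < t < PI / 2 ->
  eta r p = eta s t -> xi k r p = xi k s t -> r = s /\ p = t.
Proof.
intros Hk Hr Hs Hp Ht He Hx.
assert (H1 := eta_gt r p Hr Hp). assert (H2 := eta_gt s t Hs Ht).
rewrite <- (level_eta r p), <- (level_eta s t) in Hx |- * by assumption.
rewrite !level_eta in * by assumption.
assert (Hrp := level_eta r p Hr Hp). assert (Hst := level_eta s t Hs Ht).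
set (y := eta r p) in *. rewrite <- He in *.
destruct (Rtotal_order p t) as [H|[H|H]].
- assert (h := xi_level_lt k y p t Hk). rewrite Hrp, Hst in h. lra.
- subst t. split; [congruence|reflexivity].
- assert (h := xi_level_lt k y t p Hk). rewrite Hrp, Hst in h. lra.
Qed.

(** Equal values of eta therefore force two angles to have the same sign, which separates the cases
    t > 0, t = 0 and t < 0. *)
Lemma eta_sign (rho t : R) : 0 < rho -> - (PI / 2) < t < PI / 2 ->
  (0 < t -> 0 < eta rho t) /\ (t = 0 -> eta rho t = 0) /\ (t < 0 -> eta rho t < 0).
Proof.
intros Hr Ht; repeat split; intros H.
- assert (h := eta_gt rho t Hr); lra.
- subst; apply eta_0.
- assert (h := eta_gt rho (- t) Hr). rewrite eta_opp in h; lra.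
Qed.

Lemma xi_eta_inj (k r s p t : R) : 0 < k <= 1 -> 0 < r -> 0 < s ->
  - (PI / 2) < p < PI / 2 -> - (PI / 2) < t < PI / 2 ->
  eta r p = eta s t -> xi k r p = xi k s t -> r = s /\ p = t.
Proof.
intros Hk Hr Hs Hp Ht He Hx.
destruct (eta_sign r p Hr Hp) as [P1 [P2 P3]]. destruct (eta_sign s t Hs Ht) as [T1 [T2 T3]].
(* Mixed signs contradict [He]. Negative angles are reflected to positive ones, and on the axis xi
   is monotone in the radius. *)
destruct (Rtotal_order p 0) as [H|[H|H]]; destruct (Rtotal_order t 0) as [H'|[H'|H']];
  try (specialize (P1 H)); try (specialize (P2 H)); try (specialize (P3 H));
  try (specialize (T1 H')); try (specialize (T2 H')); try (specialize (T3 H')); try lra.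
- destruct (xi_eta_inj_pos k r s (- p) (- t)) as [h1 h2]; try lra.
  + rewrite !eta_opp; lra.
  + now rewrite !xi_opp.
- subst. split; [|reflexivity].
  destruct (Rtotal_order r s) as [h|[h|h]]; [|exact h|].
  + assert (h' := xi_0_incr k r s Hk); lra.
  + assert (h' := xi_0_incr k s r Hk); lra.
- apply (xi_eta_inj_pos k); auto; lra.
Qed.

(** The level set is a graph over an interval of angles: the condition 2 q < y holds between p and t
    because it holds at both. The intermediate value theorem along this curve yields x. *)
Lemma xi_eta_connected_pos (k r s p t x : R) : 0 < k <= 1 -> 0 < r -> 0 < s ->
  0 < p < PI / 2 -> 0 < t < PI / 2 ->
  eta r p = eta s t -> xi k r p <= x <= xi k s t ->
  exists rho q, 0 < rho /\ 0 < q < PI / 2 /\ eta rho q = eta r p /\ xi k rho q = x.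
Proof.
intros Hk Hr Hs Hp Ht He Hx.
assert (H1 := eta_gt r p Hr Hp). assert (H2 := eta_gt s t Hs Ht).
assert (Hrp := level_eta r p Hr Hp). assert (Hst := level_eta s t Hs Ht).
set (y := eta r p) in *. rewrite <- He in *.
assert (Hcont : forall q, 0 < q < PI / 2 -> 2 * q < y -> continuity_pt (fun q => xi k (level y q) q) q).
{ intros q Hq Hqy; destruct (xi_level_decr k y q Hk Hq Hqy) as [d [Hd _]].
  now apply is_derive_continuity_pt with d. }
assert (Hex : exists q, 0 < q < PI / 2 /\ 2 * q < y /\ xi k (level y q) q = x).
{ destruct (Rle_or_lt p t) as [H|H].
  - destruct (intermediate_value (fun q => xi k (level y q) q) p t x) as [q [Hq Hq']].
    + exact H.
    + intros q Hq; apply Hcont; lra.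
    + left; now rewrite Hrp, Hst.
    + exists q; repeat split; try lra.
  - destruct (intermediate_value (fun q => xi k (level y q) q) t p x) as [q [Hq Hq']].
    + lra.
    + intros q Hq; apply Hcont; lra.
    + right; now rewrite Hrp, Hst.
    + exists q; repeat split; try lra. }
destruct Hex as [q [Hq [Hqy Hqx]]].
exists (level y q), q; repeat split; try lra.
- now apply sqrt_lt_R0, level_pos.
- now apply eta_level.
Qed.

Lemma xi_eta_connected (k r s p t x : R) : 0 < k <= 1 -> 0 < r -> 0 < s ->
  - (PI / 2) < p < PI / 2 -> - (PI / 2) < t < PI / 2 ->
  eta r p = eta s t -> xi k r p <= x <= xi k s t ->
  exists rho q, 0 < rho /\ - (PI / 2) < q < PI / 2 /\ eta rho q = eta r p /\ xi k rho q = x.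
Proof.
intros Hk Hr Hs Hp Ht He Hx.
destruct (eta_sign r p Hr Hp) as [P1 [P2 P3]]. destruct (eta_sign s t Hs Ht) as [T1 [T2 T3]].
destruct (Rtotal_order p 0) as [H|[H|H]]; destruct (Rtotal_order t 0) as [H'|[H'|H']];
  try (specialize (P1 H)); try (specialize (P2 H)); try (specialize (P3 H));
  try (specialize (T1 H')); try (specialize (T2 H')); try (specialize (T3 H')); try lra.
- destruct (xi_eta_connected_pos k r s (- p) (- t) x) as [rho [q [h1 [h2 [h3 h4]]]]]; try lra.
  + rewrite !eta_opp; lra.
  + now rewrite !xi_opp.
  + exists rho, (- q); repeat split; try lra.
    * rewrite eta_opp, h3, eta_opp; ring.
    * now rewrite xi_opp.
- subst p t.
  (* On the axis the level set eta = 0 is parametrized by the radius, and monotonicity of xi orders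
     r and s. *)
  assert (Hrs : r <= s).
  { destruct (Rle_or_lt r s) as [h|h]; [exact h|]. assert (h' := xi_0_incr k s r Hk); lra. }
  destruct (intermediate_value (fun rho => xi k rho 0) r s x) as [rho [Hrho Hrho']].
  + exact Hrs.
  + intros q Hq. eapply is_derive_continuity_pt. unfold xi. auto_derive; [lra|reflexivity].
  + now left.
  + exists rho, 0; repeat split; try lra. now rewrite !eta_0.
- destruct (xi_eta_connected_pos k r s p t x) as [rho [q [h1 [h2 [h3 h4]]]]]; try lra; try assumption.
  exists rho, q; repeat split; try lra; assumption.
Qed.

Open Scope C_scope.

(** * Logarithm and polar coordinates *)

Lemma disk_sqr (z : C) : disk z <-> (Re z ^ 2 + Im z ^ 2 < 1)%R.
Proof.
unfold disk; rewrite <- Cmod2_alt. assert (h := Cmod_ge_0 z). split; intros H; nra.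
Qed.

Lemma one_minus_sqr (z : C) : disk z -> 1 - z ^ 2 <> 0.
Proof.
intros Hz. replace (1 - z ^ 2) with ((1 - z) * (1 + z)) by ring.
apply Cmult_neq_0; [now apply disk_one_minus|now apply disk_one_plus].
Qed.

(** The right side is the argument of (1 + z)/(1 - z). Along t |-> t z both sides vanish at t = 0
    and have the same derivative on [0, 1]. *)
Lemma Im_log_disk (L : C -> C) (z : C) :
  L 0 = 0 -> (forall w, disk w -> is_cderive L w (2 / (1 - w ^ 2))) -> disk z ->
  Im (L z) = atan (2 * Im z / (1 - (Re z ^ 2 + Im z ^ 2))).
Proof.
intros L0 HL Hz.
apply disk_sqr in Hz. set (p := Re z) in *. set (q := Im z) in *.
set (m := (p ^ 2 + q ^ 2)%R) in *.
set (D := fun t : R => (Im (L (t * z)%C) - atan (2 * t * q / (1 - t ^ 2 * m)))%R).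
assert (Hm : (0 <= m)%R) by (unfold m; nra).
assert (HD : D 0%R = D 1%R).
{ apply (eq_is_derive (V := R_NormedModule)); [|lra]. intros t Ht.
  assert (Ht2 : (t ^ 2 <= 1)%R) by nra.
  assert (Htm : (t ^ 2 * m < 1)%R) by nra.
  assert (Htz : disk (t * z)).
  { apply disk_sqr. replace (Re (t * z)) with (t * p)%R by (unfold p; destruct z; cbn; ring).
    replace (Im (t * z)) with (t * q)%R by (unfold q; destruct z; cbn; ring).
    unfold m in Htm; lra. }
  assert (H1 := proj2 (is_cderive_along_ray _ _ _ _ (HL _ Htz))).
  assert (H2 : is_derive (fun t : R => atan (2 * t * q / (1 - t ^ 2 * m)))%R t
     (2 * q * (1 + t ^ 2 * m) / ((1 - t ^ 2 * m) ^ 2 + 4 * t ^ 2 * q ^ 2))%R).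
  { auto_derive; [lra|]. field. split; nra. }
  assert (Hden : (0 < (1 - t ^ 2 * m) ^ 2 + 4 * t ^ 2 * q ^ 2)%R) by nra.
  (* Both sides are |1 - (t z)^2|^2: the left one comes from the arctangent, the right one from the
     derivative of L. *)
  assert (Hden2 : ((1 - t ^ 2 * m) ^ 2 + 4 * t ^ 2 * q ^ 2 =
    (1 - t ^ 2 * (p ^ 2 - q ^ 2)) ^ 2 + (2 * t ^ 2 * p * q) ^ 2)%R) by (unfold m; ring).
  replace (@zero R_NormedModule) with
   (minus (Im (z * (2 / (1 - (t * z) ^ 2)))%C) (2 * q * (1 + t ^ 2 * m) / ((1 - t ^ 2 * m) ^ 2 + 4 * t ^ 2 * q ^ 2)))%R.
  - apply (is_derive_minus (V := R_NormedModule)); [exact H1|exact H2].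
  - change (Im (z * (2 / (1 - (t * z) ^ 2)))%C - 2 * q * (1 + t ^ 2 * m) /
      ((1 - t ^ 2 * m) ^ 2 + 4 * t ^ 2 * q ^ 2) = 0)%R.
    apply Rminus_diag_eq.
    rewrite Hden2. rewrite Hden2 in Hden. unfold m. clear - Hden. unfold p, q in *. destruct z as [x y]; cbn in *. field.
    apply Rgt_not_eq; eapply Rlt_le_trans; [exact Hden|right; ring]. }
unfold D in HD. replace (RtoC 0 * z) with (0 : C) in HD by ring.
replace (RtoC 1 * z) with z in HD by ring. rewrite L0 in HD.
replace (2 * 0 * q / (1 - 0 ^ 2 * m))%R with 0%R in HD by (field; lra).
rewrite atan_0 in HD. replace (2 * 1 * q / (1 - 1 ^ 2 * m))%R with (2 * q / (1 - m))%R in HD by (field; lra).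
change (Im 0) with 0%R in HD. lra.
Qed.

(** Here d is |1 - z|^2. The real part is positive on the disk, so the values lie in the right
    half-plane. *)
Lemma w_of_cart (z : C) : disk z ->
  let d := ((1 - Re z) ^ 2 + Im z ^ 2)%R in
  (0 < d)%R /\ Re (w_of z) = ((1 - (Re z ^ 2 + Im z ^ 2)) / d)%R /\ Im (w_of z) = (2 * Im z / d)%R.
Proof.
intros Hz d. apply disk_sqr in Hz.
assert (Hd : (0 < d)%R) by (unfold d; nra).
split; [exact Hd|]. unfold d, w_of in *. destruct z as [x y]; cbn in *.
split; field; apply Rgt_not_eq; (eapply Rlt_le_trans; [exact Hd|right; ring]).
Qed.

Lemma Im_log_polar (L : C -> C) (z : C) (r t : R) :
  L 0 = 0 -> (forall w, disk w -> is_cderive L w (2 / (1 - w ^ 2))) -> disk z ->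
  (0 < r)%R -> (- (PI / 2) < t < PI / 2)%R -> w_of z = r * cis t -> Im (L z) = t.
Proof.
intros L0 HL Hz Hr Ht Hw.
rewrite (Im_log_disk L z L0 HL Hz).
destruct (w_of_cart z Hz) as [Hd [H1 H2]].
set (d := ((1 - Re z) ^ 2 + Im z ^ 2)%R) in *.
assert (Hc : (0 < cos t)%R) by (apply cos_gt_0; lra).
assert (Hre : Re (w_of z) = (r * cos t)%R) by (rewrite Hw; cbn; ring).
assert (Him : Im (w_of z) = (r * sin t)%R) by (rewrite Hw; cbn; ring).
apply disk_sqr in Hz.
replace (2 * Im z / (1 - (Re z ^ 2 + Im z ^ 2)))%R with (Im (w_of z) / Re (w_of z))%R
  by (rewrite H1, H2; field; split; lra).
replace (Im (w_of z) / Re (w_of z))%R with (tan t) by (rewrite Hre, Him; unfold tan; field; split; lra).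
apply atan_tan; lra.
Qed.

Lemma polar_right_half_plane (w : C) : (0 < Re w)%R ->
  exists r t, (0 < r)%R /\ (- (PI / 2) < t < PI / 2)%R /\ w = r * cis t.
Proof.
intros Hw. set (t := atan (Im w / Re w)).
assert (Ht := atan_bound (Im w / Re w)). fold t in Ht.
assert (Hc : (0 < cos t)%R) by (apply cos_gt_0; lra).
exists (Re w / cos t)%R, t; split; [now apply Rdiv_lt_0_compat|split; [lra|]].
assert (Htan : (sin t / cos t = Im w / Re w)%R) by apply (tan_atan (Im w / Re w)).
assert (Hsin : (sin t = Im w / Re w * cos t)%R) by (rewrite <- Htan; field; lra).
apply injective_projections; cbn.
- change (fst w) with (Re w). field; lra.
- change (snd w) with (Im w). rewrite Hsin. field; lra.
Qed.

Lemma w_of_polar (z : C) : disk z ->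
  exists r t, (0 < r)%R /\ (- (PI / 2) < t < PI / 2)%R /\ w_of z = r * cis t.
Proof.
intros Hz; apply polar_right_half_plane.
destruct (w_of_cart z Hz) as [Hd [-> _]]. apply disk_sqr in Hz. apply Rdiv_lt_0_compat; lra.
Qed.

Lemma w_of_inj (z1 z2 : C) : disk z1 -> disk z2 -> w_of z1 = w_of z2 -> z1 = z2.
Proof.
intros H1 H2 H. apply disk_one_minus in H1, H2. unfold w_of in H.
(* The inverse z = (w - 1)/(w + 1), in the form 1 - 2/(w + 1). *)
assert (E : forall z, 1 - z <> 0 -> z = 1 - 2 / ((1 + z) / (1 - z) + 1)).
{ intros z Hz. field. split; [exact Hz|]. replace (1 + z + (1 - z)) with (RtoC 2) by (apply injective_projections; cbn; ring).
  intros h. injection h. lra. }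
rewrite (E z1 H1), (E z2 H2), H; reflexivity.
Qed.

Lemma w_of_onto (w : C) : (0 < Re w)%R -> exists z, disk z /\ w_of z = w.
Proof.
intros Hw.
assert (Hw1 : w + 1 <> 0) by (destruct w; cbn in *; intros h; injection h; lra).
exists ((w - 1) / (w + 1)). split.
- unfold disk, Cdiv. rewrite Cmod_mult, Cmod_inv by exact Hw1.
  apply Cmod_gt_0 in Hw1. apply (Rmult_lt_reg_r (Cmod (w + 1))); [exact Hw1|].
  rewrite Rmult_assoc, Rinv_l, Rmult_1_l, Rmult_1_r by lra.
  apply Rsqr_incrst_0; try apply Cmod_ge_0.
  rewrite !Rsqr_pow2, !Cmod2_alt. destruct w; cbn in *; lra.
- unfold w_of. field. split; [exact Hw1|].
  replace (w + 1 - (w - 1)) with (RtoC 2) by ring. intros h; injection h; lra.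
Qed.

(** Taking c r as radius leaves c^2 as the only parameter of xi and none in eta. The angle t is both
    the argument of w and the imaginary part of its logarithm l. *)
Lemma conv_polar (c r t : R) (l : C) : (0 < c)%R -> (0 < r)%R -> Im l = t ->
  (16 * c * Re (conv_sum c (r * cis t)) = xi (c ^ 2) (c * r) t - 4 * c)%R /\
  (16 * c * Im (conv_diff c l (r * cis t)) = eta (c * r) t)%R.
Proof.
intros Hc Hr <-. set (t := Im l).
assert (Hinv : / (r * cis t) = (/ r)%R * (cos t, (- sin t)%R)).
{ assert (h := cis_neq_0 t).
  assert (hr : RtoC r <> 0) by (intros e; injection e; lra).
  rewrite RtoC_inv by lra.
  assert (h2 : cis t * (cos t, (- sin t)%R) = 1).
  { assert (s := sin2_cos2 t); unfold Rsqr in s.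
    apply injective_projections; cbn; [rewrite <- s|]; ring. }
  transitivity (/ (r * cis t) * (cis t * (cos t, (- sin t)%R))); [rewrite h2; ring|].
  field; split; assumption. }
assert (s := sin2_cos2 t); unfold Rsqr in s.
assert (Hs : (sin t ^ 2 = 1 - cos t ^ 2)%R) by lra.
split.
- unfold conv_sum. rewrite Hinv.
  replace (_ / 16) with (RtoC (/ 16) * (RtoC (c ^ 2) * (r * cis t) ^ 3 + RtoC (5 - c ^ 2) * (r * cis t) - (/ r)%R * (cos t, (- sin t)%R) - 4)).
  2:{ rewrite RtoC_inv, RtoC_minus, RtoC_pow by lra. field. }
  rewrite re_scal_l. unfold xi.
  replace (Re _) with (c ^ 2 * (r ^ 3 * (cos t ^ 3 - 3 * cos t * sin t ^ 2)) + (5 - c ^ 2) * (r * cos t) - / r * cos t - 4)%R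
   by (cbn; ring).
  rewrite Hs. field. lra.
- unfold conv_diff.
  replace (_ / 16) with (RtoC (/ 16) * (RtoC (2 / c) * l + RtoC (3 * c) * ((r * cis t) ^ 2 - 1))).
  2:{ rewrite RtoC_inv, RtoC_div, RtoC_mult by lra. field. intros e; injection e; lra. }
  replace (Im _) with (/ 16 * (2 / c * t + 3 * c * (2 * r ^ 2 * sin t * cos t)))%R.
  2:{ unfold t; destruct l; cbn; ring. }
  unfold eta. field. lra.
Qed.

(** * The Jacobian of the convolution *)

Lemma is_cderive_w_of (z : C) : disk z -> is_cderive w_of z (2 / (1 - z) ^ 2).
Proof.
intros Hz. assert (H1 := disk_one_minus z Hz).
eapply is_cderive_value.
- apply is_cderive_mult.
  + apply is_cderive_plus; [apply is_cderive_const|apply is_cderive_id].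
  + apply is_cderive_inv; [exact H1|].
    apply is_cderive_minus; [apply is_cderive_const|apply is_cderive_id].
- simpl. field. exact H1.
Qed.

Lemma w_of_neq_0 (z : C) : disk z -> w_of z <> 0.
Proof.
intros Hz. unfold w_of, Cdiv. apply Cmult_neq_0; [now apply disk_one_plus|].
intros h. assert (H1 := disk_one_minus z Hz).
assert (E : (1 - z) * / (1 - z) = 1) by now apply Cinv_r.
rewrite h, Cmult_0_r in E. injection E; lra.
Qed.

(** The derivatives of S and T with respect to w, where dl/dw = 1/w. *)
Definition dsum (c w : C) : C := (3 * c ^ 2 * w ^ 2 + (5 - c ^ 2) + / w ^ 2) / 16.
Definition ddiff (c w : C) : C := (2 / (c * w) + 6 * c * w) / 16.

Lemma is_cderive_conv_sum (c w : C) : w <> 0 -> is_cderive (conv_sum c) w (dsum c w).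
Proof.
intros Hw. eapply is_cderive_value.
- unfold conv_sum. apply is_cderive_mult; [|apply is_cderive_const].
  apply is_cderive_minus; [|apply is_cderive_const].
  apply is_cderive_minus; [|now apply is_cderive_inv; [|apply is_cderive_id]].
  apply is_cderive_plus; apply is_cderive_scal; [apply is_cderive_pow|apply is_cderive_id].
- unfold dsum. replace (INR 3) with 3%R by (simpl; ring). field. exact Hw.
Qed.

(** The given derivative 2/(1 - z^2) of L is 1/w times dw/dz = 2/(1 - z)^2, so that T differentiates
    as a function of w. *)
Lemma is_cderive_conv_diff (c : C) (L : C -> C) (z : C) : c <> 0 -> disk z ->
  is_cderive L z (2 / (1 - z ^ 2)) ->
  is_cderive (fun z => conv_diff c (L z) (w_of z)) z (2 / (1 - z) ^ 2 * ddiff c (w_of z)).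
Proof.
intros Hc Hz HL.
assert (H1 := disk_one_minus z Hz). assert (H2 := disk_one_plus z Hz).
assert (H3 := one_minus_sqr z Hz).
eapply is_cderive_value.
- unfold conv_diff. apply is_cderive_mult; [|apply is_cderive_const].
  apply is_cderive_plus.
  + apply is_cderive_mult; [|apply is_cderive_const].
    apply is_cderive_scal, HL.
  + apply is_cderive_scal, is_cderive_minus; [|apply is_cderive_const].
    apply (is_cderive_comp (fun w => w ^ 2)); [apply is_cderive_pow|now apply is_cderive_w_of].
- unfold ddiff, w_of. replace (INR 2) with 2%R by (simpl; ring). field. repeat split; auto.
Qed.

Lemma is_cderive_rotated_conv (k e c : C) (L : C -> C) (z : C) :
  c <> 0 -> (disk (e * z)) -> is_cderive L (e * z) (2 / (1 - (e * z) ^ 2)) ->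
  is_cderive (fun z => k * (conv_sum c (w_of (e * z)) + conv_diff c (L (e * z)) (w_of (e * z)))) z
    (k * e * (2 / (1 - e * z) ^ 2) * (dsum c (w_of (e * z)) + ddiff c (w_of (e * z)))).
Proof.
intros Hc Hz HL.
assert (H1 := disk_one_minus _ Hz).
eapply is_cderive_value.
- apply is_cderive_scal.
  apply (is_cderive_comp (fun u => conv_sum c (w_of u) + conv_diff c (L u) (w_of u)) (fun z => e * z)).
  + apply is_cderive_plus.
    * apply (is_cderive_comp (conv_sum c)); [apply is_cderive_conv_sum; now apply w_of_neq_0|].
      now apply is_cderive_w_of.
    * now apply is_cderive_conv_diff.
  + apply is_cderive_scal, is_cderive_id.
- ring.
Qed.

(** With n = |w|^2, clearing denominators by w conj(w) = n turns the real part into a positive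
    multiple of the polynomial of [jacobian_pos], at k = c^2, q = c^2 n and s = x^2 / n, the squared
    cosine of the argument of w. *)
Lemma jacobian_conv (c : R) (w : C) : (0 < c <= 1)%R -> (0 < Re w)%R ->
  (0 < Re (dsum c w * Cconj (ddiff c w)))%R.
Proof.
intros Hc Hw. destruct w as [x y]; simpl in Hw.
set (n := (x ^ 2 + y ^ 2)%R).
assert (Hn : (0 < n)%R) by (unfold n; nra).
assert (Hw0 : ((x, y) : C) <> 0) by (intros h; injection h; lra).
assert (Hwc0 : Cconj (x, y) <> 0) by (intros h; injection h; lra).
assert (Hc0 : RtoC c <> 0) by (intros h; injection h; lra).
assert (H16 : RtoC 16 <> 0) by (intros h; injection h; lra).
set (w := ((x, y) : C)) in *.
assert (Hwn : RtoC n = w * Cconj w) by (apply injective_projections; unfold n; cbn; ring).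
assert (E : dsum c w * Cconj (ddiff c w) = RtoC (/ (256 * c * n ^ 2)) *
  (Cconj w * (3 * c ^ 2 * w ^ 4 + (5 - c ^ 2) * w ^ 2 + 1) * (2 + 6 * c ^ 2 * Cconj w ^ 2))).
{ unfold dsum, ddiff.
  assert (Hc2 : Cconj ((2 / (c * w) + 6 * c * w) / 16) = (2 / (c * Cconj w) + 6 * c * Cconj w) / 16).
  { assert (Hr : forall r : R, Cconj r = r) by (intros r; apply injective_projections; cbn; ring).
    rewrite Cdiv_conj, Cplus_conj, Cdiv_conj, !Cmult_conj, !Hr by (try assumption; now apply Cmult_neq_0).
    reflexivity. }
  rewrite Hc2, RtoC_inv, !RtoC_mult, RtoC_pow, Hwn by (apply Rgt_not_eq; repeat apply Rmult_lt_0_compat; nra).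
  field. repeat split; assumption. }
rewrite E, re_scal_l.
assert (Hq : (0 < c ^ 2 <= 1)%R) by nra.
assert (Hqn : (0 < c ^ 2 * n)%R) by nra.
apply Rmult_lt_0_compat; [apply Rinv_0_lt_compat; repeat apply Rmult_lt_0_compat; nra|].
replace (Re _) with (x * / c ^ 2 * (18 * (c ^ 2 * n) ^ 3 + (12 - 6 * c ^ 2) * (c ^ 2 * n) ^ 2 + (10 - 20 * c ^ 2) * (c ^ 2 * n) + 2 * c ^ 2 + 24 * (x ^ 2 / n) * ((c ^ 2 * n) ^ 2 + c ^ 2 * (c ^ 2 * n))))%R.
- assert (0 < x * / c ^ 2)%R by (apply Rmult_lt_0_compat; [lra|apply Rinv_0_lt_compat; nra]).
  apply Rmult_lt_0_compat; [assumption|]. apply jacobian_pos; try assumption.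
  apply Rdiv_lt_0_compat; nra.
- clear - Hc Hn. unfold n, w in *. cbn. field. cbn in Hn. split; nra.
Qed.

(** * Normalization and the shape of the half-plane mapping *)

Lemma is_cderive_C_derive (f : C -> C) (z : C) :
  ex_derive (K := C_AbsRing) (V := C_NormedModule) f z -> is_cderive f z (C_derive f z).
Proof. intros H. exact (C_derive_correct f z 0 H). Qed.

Lemma C_derive_eq (f : C -> C) (z l : C) : is_cderive f z l -> C_derive f z = l.
Proof. exact (is_C_derive_unique f z l). Qed.

Lemma RtoC_neq_0 (r : R) : r <> 0%R -> RtoC r <> 0.
Proof. intros H h; injection h; exact H. Qed.

(** Jacobians multiply under composition with the real-linear map v |-> conj(A) v - B conj(v), whose
    own Jacobian is |A|^2 - |B|^2. *)
Lemma Cmod_sqr_sub_affine (A B x y : C) :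
  (Cmod (Cconj A * x - B * y) ^ 2 - Cmod (A * y - Cconj B * x) ^ 2 =
   (Cmod A ^ 2 - Cmod B ^ 2) * (Cmod x ^ 2 - Cmod y ^ 2))%R.
Proof. rewrite !Cmod2_alt. destruct A, B, x, y; cbn; ring. Qed.

(** The normalization composes f with a real-linear map of positive Jacobian 1/J. Orientation is
    kept, and injectivity too since v |-> A v + B conj(v) inverts the map. *)
Lemma S_H0_affine_normalization (f : harmonic_pair) :
  sense_preserving_univalent f -> S_H0 (affine_normalization f).
Proof.
intros [[Hh Hg] [Hs [Hu H0]]].
assert (D0 : disk 0) by (unfold disk; rewrite Cmod_0; lra).
set (A := d_z f 0). set (B := d_zbar f 0).
set (J := (Cmod A ^ 2 - Cmod B ^ 2)%R).
assert (HJ : (0 < J)%R) by exact (Hs 0 D0).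
assert (HJ0 : RtoC J <> 0) by (apply RtoC_neq_0; lra).
assert (Dh : forall z, disk z -> is_cderive (hpart (affine_normalization f)) z
   ((Cconj A * C_derive (hpart f) z - B * C_derive (gpart f) z) / J)).
{ intros z Hz. eapply is_cderive_value.
  - apply is_cderive_mult; [|apply is_cderive_const].
    apply is_cderive_minus; apply is_cderive_scal, is_cderive_C_derive; [now apply Hh|now apply Hg].
  - fold A B J; cbv beta. field. exact HJ0. }
assert (Dg : forall z, disk z -> is_cderive (gpart (affine_normalization f)) z
   ((A * C_derive (gpart f) z - Cconj B * C_derive (hpart f) z) / J)).
{ intros z Hz. eapply is_cderive_value.
  - apply is_cderive_mult; [|apply is_cderive_const].
    apply is_cderive_minus; apply is_cderive_scal, is_cderive_C_derive; [now apply Hg|now apply Hh].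
  - fold A B J; cbv beta. field. exact HJ0. }
assert (HJc : Cconj J = J) by (apply injective_projections; cbn; ring).
assert (Hval : forall z, affine_normalization f z = (Cconj A * f z - B * Cconj (f z)) / J).
{ intros z. unfold heval, affine_normalization; cbn [hpart gpart]. fold A B J.
  rewrite Cdiv_conj, HJc, Cminus_conj, !Cmult_conj, Cconj_conj, Cplus_conj, Cconj_conj by exact HJ0.
  field. exact HJ0. }
split; [split; [split|split; [|split]]|split].
- intros z Hz; eexists; now apply Dh.
- intros z Hz; eexists; now apply Dg.
- intros z Hz. unfold d_z, d_zbar.
  rewrite (C_derive_eq _ _ _ (Dh z Hz)), (C_derive_eq _ _ _ (Dg z Hz)), Cmod_conj.
  unfold Cdiv; rewrite !Cmod_mult, !Rpow_mult_distr, <- Rmult_minus_distr_r, Cmod_sqr_sub_affine.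
  fold J.
  assert (h := Hs z Hz). unfold d_z, d_zbar in h. rewrite Cmod_conj in h.
  apply Rmult_lt_0_compat; [now apply Rmult_lt_0_compat|].
  apply pow_lt. rewrite Cmod_inv by exact HJ0. now apply Rinv_0_lt_compat, Cmod_gt_0.
- intros z w Hz Hw. rewrite !Hval. intros E. apply (Hu z w Hz Hw).
  (* [A] times the normalization plus [B] times its conjugate is [f]. *)
  assert (R : forall v, v = (A * ((Cconj A * v - B * Cconj v) / J) + B * Cconj ((Cconj A * v - B * Cconj v) / J))).
  { intros v. assert (HJe : RtoC J = A * Cconj A - B * Cconj B).
    { unfold J. rewrite RtoC_minus. now rewrite <- !Cmod2_conj. }
    rewrite Cdiv_conj, HJc, Cminus_conj, !Cmult_conj, !Cconj_conj by exact HJ0.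
    rewrite HJe in HJ0 |- *. field. exact HJ0. }
  rewrite (R (f z)), (R (f w)), E. reflexivity.
- rewrite Hval, H0. replace (Cconj 0) with (RtoC 0) by (apply injective_projections; cbn; ring).
  field. exact HJ0.
- unfold d_z. rewrite (C_derive_eq _ _ _ (Dh 0 D0)).
  assert (HB : C_derive (gpart f) 0 = Cconj B) by (unfold B, d_zbar; now rewrite Cconj_conj).
  rewrite HB. change (C_derive (hpart f) 0) with A.
  assert (HJe : RtoC J = A * Cconj A - B * Cconj B).
  { unfold J. rewrite RtoC_minus. now rewrite <- !Cmod2_conj. }
  rewrite HJe in HJ0 |- *. field. exact HJ0.
- unfold d_zbar. rewrite (C_derive_eq _ _ _ (Dg 0 D0)).
  assert (HB : C_derive (gpart f) 0 = Cconj B) by (unfold B, d_zbar; now rewrite Cconj_conj).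
  rewrite HB. change (C_derive (hpart f) 0) with A.
  replace ((A * Cconj B - Cconj B * A) / J) with (RtoC 0) by (field; exact HJ0).
  apply injective_projections; cbn; ring.
Qed.

(** The derivative of h is (h' + g') / (1 + omega), a known rational function, and the partial
    fractions of h leave a logarithm. As g = z/(1 - z) - h, its formula is that of h with -c in
    place of c. *)
Lemma right_half_plane_log (a : R) (f : harmonic_pair) (c := ((1 - a) / (1 + a))%R) :
  (0 <= a < 1)%R -> harmonic f -> hpart f 0 = 0 ->
  (forall z : C, disk z -> hpart f z + gpart f z = z / (1 - z)) ->
  has_dilatation f (fun z => - ((a - z) ^ 2 / (1 - a * z) ^ 2)) ->
  exists L : C -> C, L 0 = 0 /\ (forall z, disk z -> is_cderive L z (2 / (1 - z ^ 2))) /\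
    (forall z, disk z -> hpart f z = / 2 * (z / (1 - z) + c / 2 * (z / (1 - z) ^ 2) + / (4 * c) * L z)) /\
    (forall z, disk z -> gpart f z = / 2 * (z / (1 - z) + - c / 2 * (z / (1 - z) ^ 2) + / (4 * - c) * L z)).
Proof.
intros Ha [Hh Hg] Hf0 Hsum Hdil.
assert (Hc : (0 < c)%R) by (apply Rdiv_lt_0_compat; lra).
assert (Hc0 : RtoC c <> 0) by (apply RtoC_neq_0; lra).
assert (Hmc0 : RtoC c <> 0 /\ - RtoC c <> 0).
{ split; [exact Hc0|]. rewrite <- RtoC_opp. apply RtoC_neq_0; lra. }
(* The formula for [hpart f] solved for L; what remains to be proved is the derivative of L. *)
exists (fun z => 4 * c * (2 * hpart f z - z * / (1 - z) - c / 2 * (z * / ((1 - z) * (1 - z))))).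
split; [|split; [|split]].
- rewrite Hf0. ring.
- intros z Hz.
  assert (H1 := disk_one_minus z Hz). assert (H2 := disk_one_plus z Hz).
  assert (H3 : 1 - a * z <> 0).
  { apply disk_one_minus. unfold disk in *. rewrite Cmod_mult, Cmod_R, Rabs_pos_eq by lra.
    assert (h := Cmod_ge_0 z). nra. }
  assert (H4 := one_minus_sqr z Hz).
  assert (H5 : 1 - RtoC a <> 0) by (rewrite <- RtoC_minus; apply RtoC_neq_0; lra).
  assert (H6 : 1 + RtoC a <> 0) by (rewrite <- RtoC_plus; apply RtoC_neq_0; lra).
  assert (Dh := is_cderive_C_derive _ _ (Hh z Hz)).
  assert (Dg := is_cderive_C_derive _ _ (Hg z Hz)).
  destruct (Hdil z Hz) as [Hn Hw].
  set (h1 := C_derive (hpart f) z) in *. set (g1 := C_derive (gpart f) z) in *.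
  assert (Hfrac : is_cderive (fun w => w * / (1 - w)) z (1 / ((1 - z) * (1 - z)))).
  { eapply is_cderive_value.
    - apply is_cderive_mult; [apply is_cderive_id|apply is_cderive_inv; [exact H1|]].
      apply is_cderive_minus; [apply is_cderive_const|apply is_cderive_id].
    - cbv beta; field. exact H1. }
  assert (Hfrac2 : is_cderive (fun w => w * / ((1 - w) * (1 - w))) z ((1 + z) / ((1 - z) * (1 - z) * (1 - z)))).
  { eapply is_cderive_value.
    - apply is_cderive_mult; [apply is_cderive_id|apply is_cderive_inv; [now apply Cmult_neq_0|]].
      apply is_cderive_mult; (apply is_cderive_minus; [apply is_cderive_const|apply is_cderive_id]).
    - cbv beta; field. exact H1. }
  assert (Hsum1 : h1 + g1 = 1 / ((1 - z) * (1 - z))).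
  { rewrite <- (C_derive_eq _ _ _ Hfrac). symmetry. apply C_derive_eq.
    apply is_cderive_ext_disk with (fun w => hpart f w + gpart f w); [exact Hz|exact Hsum|].
    now apply is_cderive_plus. }
  assert (Hg1 : g1 = - ((a - z) ^ 2 / (1 - a * z) ^ 2) * h1) by (rewrite <- Hw; field; exact Hn).
  (* Uses (1 - a z)^2 - (a - z)^2 = (1 - a^2)(1 - z^2), the numerator of 1 + omega. *)
  assert (Hh1 : h1 = (1 - a * z) ^ 2 / ((1 - a) * (1 + a) * ((1 - z) * (1 + z)) * ((1 - z) * (1 - z)))).
  { assert (E : h1 * ((1 - a) * (1 + a) * ((1 - z) * (1 + z))) = (1 - a * z) ^ 2 * (h1 + g1)).
    { rewrite Hg1. field. exact H3. }
    rewrite Hsum1 in E.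
    replace h1 with (h1 * ((1 - a) * (1 + a) * ((1 - z) * (1 + z))) / ((1 - a) * (1 + a) * ((1 - z) * (1 + z)))) by (field; repeat split; assumption).
    rewrite E. field; repeat split; assumption. }
  eapply is_cderive_value.
  + apply is_cderive_scal. apply is_cderive_minus; [|apply is_cderive_scal, Hfrac2].
    apply is_cderive_minus; [apply is_cderive_scal, Dh|exact Hfrac].
  + cbv beta. rewrite Hh1. unfold c. rewrite RtoC_div, RtoC_minus, RtoC_plus by lra.
    field; repeat split; assumption.
- intros z Hz. assert (H1 := disk_one_minus z Hz). field. split; assumption.
- intros z Hz. assert (H1 := disk_one_minus z Hz).
  replace (gpart f z) with (z / (1 - z) - hpart f z) by (rewrite <- Hsum by exact Hz; ring).
  field. repeat split; try assumption; apply Hmc0.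
Qed.

(** * Taylor series of the factors and closed form of the convolution *)

Lemma is_cseries_half_plane (c z l : C) : disk z ->
  is_cseries (fun n => log_coeff n * z ^ n) l ->
  is_cseries (fun n => / 2 * (nonconst n + c / 2 * INR n + / (4 * c) * log_coeff n) * z ^ n)
    (/ 2 * (z / (1 - z) + c / 2 * (z / (1 - z) ^ 2) + / (4 * c) * l)).
Proof.
intros Hz Hl.
eapply is_cseries_ext; [|apply is_cseries_scal, is_cseries_plus; [apply is_cseries_plus;
  [apply (shifted_geom_series _ Hz)|apply is_cseries_scal, (arith_geom_series _ Hz)]|
  apply is_cseries_scal, Hl]].
intros n; cbv beta; ring.
Qed.

Lemma hadamard_slanted_half_plane (phi psi L : C -> C) (e k c z : C) :
  c <> 0 -> L 0 = 0 -> (forall w, disk w -> is_cderive L w (2 / (1 - w ^ 2))) ->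
  (forall w, disk w -> disk (e * w)) ->
  (forall w, disk w -> phi w = k * (e * w / (1 - e * w) + c * (e * w / (1 - e * w) ^ 2))) ->
  (forall w, disk w -> psi w = / 2 * (w / (1 - w) + c / 2 * (w / (1 - w) ^ 2) + / (4 * c) * L w)) ->
  disk z ->
  hadamard phi psi z = k * (conv_sum c (w_of (e * z)) + conv_diff c (L (e * z)) (w_of (e * z))).
Proof.
intros Hc L0 HL He Hphi Hpsi Hz.
apply hadamard_pseries with
  (fun n => k * e ^ n * (nonconst n + c * INR n))
  (fun n => / 2 * (nonconst n + c / 2 * INR n + / (4 * c) * log_coeff n)).
- intros w Hw. rewrite Hphi by exact Hw. apply is_cpseries_cseries, is_cseries_slanted; auto.
- intros w Hw. rewrite Hpsi by exact Hw. apply is_cpseries_cseries, is_cseries_half_plane; auto.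
  apply log_series; auto.
- apply is_cseries_conv; auto. apply log_series; auto.
Qed.

(** S is even and T is odd in c, so passing from c to -c turns S + T into S - T. *)
Lemma conv_sum_opp (c w : C) : conv_sum (- c) w = conv_sum c w.
Proof. unfold conv_sum, Cdiv; ring. Qed.

Lemma conv_diff_opp (c l w : C) : c <> 0 -> conv_diff (- c) l w = - conv_diff c l w.
Proof.
intros Hc. unfold conv_diff. field. exact Hc.
Qed.

(** Since 1 + c = 2/(1 + a) and 1 - c = 2a/(1 + a), the parts of the slanted mapping are k (u/(1 -
    u) + c u/(1 - u)^2) with u = e z and k = 1/(2e), and the same expression with -c and k = e/2. *)
Lemma hadamard_f_slanted (a alpha : R) (f : harmonic_pair) (L : C -> C)
  (c := ((1 - a) / (1 + a))%R) (F := hconv (f_slanted a alpha) f) (e := cis alpha) :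
  (0 <= a < 1)%R -> L 0 = 0 -> (forall z, disk z -> is_cderive L z (2 / (1 - z ^ 2))) ->
  (forall z, disk z -> hpart f z = / 2 * (z / (1 - z) + c / 2 * (z / (1 - z) ^ 2) + / (4 * c) * L z)) ->
  (forall z, disk z -> gpart f z = / 2 * (z / (1 - z) + - c / 2 * (z / (1 - z) ^ 2) + / (4 * - c) * L z)) ->
  forall z, disk z ->
  hpart F z = / (2 * e) * (conv_sum c (w_of (e * z)) + conv_diff c (L (e * z)) (w_of (e * z))) /\
  gpart F z = e / 2 * (conv_sum c (w_of (e * z)) - conv_diff c (L (e * z)) (w_of (e * z))).
Proof.
intros Ha L0 HL Hh Hg z Hz.
assert (Hc : (0 < c)%R) by (apply Rdiv_lt_0_compat; lra).
assert (Hc0 : RtoC c <> 0) by (apply RtoC_neq_0; lra).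
assert (Hmc0 : - RtoC c <> 0) by (rewrite <- RtoC_opp; apply RtoC_neq_0; lra).
assert (He0 := cis_neq_0 alpha). fold e in He0.
assert (Ha1 : 1 + RtoC a <> 0) by (rewrite <- RtoC_plus; apply RtoC_neq_0; lra).
assert (Hdisk : forall w, disk w -> disk (e * w)) by apply disk_cis.
assert (Hce : RtoC c = (1 - a) / (1 + a)) by (unfold c; now rewrite RtoC_div, RtoC_minus, RtoC_plus by lra).
split.
- apply hadamard_slanted_half_plane; auto.
  intros w Hw. assert (H1 := disk_one_minus _ (Hdisk w Hw)).
  cbn [hpart f_slanted]. fold e. rewrite Hce. field. repeat split; assumption.
- unfold Cminus at 1. rewrite <- (conv_sum_opp c), <- (conv_diff_opp c) by exact Hc0.
  apply hadamard_slanted_half_plane; auto.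
  intros w Hw. assert (H1 := disk_one_minus _ (Hdisk w Hw)).
  cbn [gpart f_slanted].
  replace (2 * alpha)%R with (alpha + alpha)%R by ring.
  replace (3 * alpha)%R with (alpha + alpha + alpha)%R by ring.
  rewrite !cis_plus. fold e. rewrite Hce. field. repeat split; assumption.
Qed.

(** * Orientation, univalence and directional convexity of the convolution *)

Lemma Cmod_sqr_half_sum_sub (p q : C) :
  (Cmod ((p + q) / 2) ^ 2 - Cmod ((p - q) / 2) ^ 2 = Re (p * Cconj q))%R.
Proof.
unfold Cdiv. rewrite !Cmod_mult, Cmod_inv, Cmod_R, Rabs_pos_eq by (try lra; apply RtoC_neq_0; lra).
rewrite !Rpow_mult_distr, !Cmod2_alt. destruct p, q; cbn. field.
Qed.

(** For a > 0 the derivatives at 0 are not normalized, so membership in S_H^0 is stated after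
    [affine_normalization], and for the convolution itself when a = 0. Univalence and convexity
    concern the convolution itself. *)
Theorem theorem2p5 (a alpha : R)
    (ha : (0 <= a < 1)%R) (halpha : (0 <= alpha < 2 * PI)%R)
    (f : harmonic_pair) (hf : harmonic f)
    (hf0 : hpart f 0 = 0) (gf0 : gpart f 0 = 0)
    (hsum : forall z : C, disk z -> hpart f z + gpart f z = z / (1 - z))
    (hdil : has_dilatation f (fun z => - ((a - z) ^ 2 / (1 - a * z) ^ 2))) :
  sense_preserving_univalent (hconv (f_slanted a alpha) f) /\
  S_H0 (affine_normalization (hconv (f_slanted a alpha) f)) /\
  (a = 0%R -> S_H0 (hconv (f_slanted a alpha) f)) /\
  convex_in_direction (- alpha) (hconv (f_slanted a alpha) f).
Proof.
destruct (right_half_plane_log a f ha hf hf0 hsum hdil) as [L [L0 [HL [Hh Hg]]]].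
assert (HF := hadamard_f_slanted a alpha f L ha L0 HL Hh Hg). cbv zeta in HF.
set (F := hconv (f_slanted a alpha) f) in *.
set (c := ((1 - a) / (1 + a))%R) in *. set (e := cis alpha) in *.
assert (Hc : (0 < c <= 1)%R).
{ unfold c. split; [apply Rdiv_lt_0_compat; lra|].
  apply (Rmult_le_reg_r (1 + a)); [lra|]. unfold Rdiv; rewrite Rmult_assoc, Rinv_l; lra. }
assert (Hc0 : RtoC c <> 0) by (apply RtoC_neq_0; lra).
assert (Hmc0 : - RtoC c <> 0) by (rewrite <- RtoC_opp; apply RtoC_neq_0; lra).
assert (He0 : e <> 0) by apply cis_neq_0.
assert (He1 : Cmod e = 1%R) by apply Cmod_cis.
assert (Hdisk : forall w, disk w -> disk (e * w)) by apply disk_cis.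
assert (H2 : RtoC 2 <> 0) by (apply RtoC_neq_0; lra).
assert (D0 : disk 0) by (unfold disk; rewrite Cmod_0; lra).
(* The derivatives of S and T with respect to u = e z. *)
set (ds := fun z => 2 / (1 - e * z) ^ 2 * dsum c (w_of (e * z))).
set (dd := fun z => 2 / (1 - e * z) ^ 2 * ddiff c (w_of (e * z))).
assert (DH : forall z, disk z -> is_cderive (hpart F) z ((ds z + dd z) / 2)).
{ intros z Hz. apply is_cderive_ext_disk with (2 := fun w Hw => eq_sym (proj1 (HF w Hw))); [exact Hz|].
  eapply is_cderive_value; [apply is_cderive_rotated_conv; auto|].
  unfold ds, dd. field. repeat split; try assumption. apply disk_one_minus; auto. }
assert (DG : forall z, disk z -> is_cderive (gpart F) z (e ^ 2 * ((ds z - dd z) / 2))).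
(* The co-analytic part is written with -c to have the shape S + T. *)
{ intros z Hz. apply is_cderive_ext_disk with
    (fun w => e / 2 * (conv_sum (- c) (w_of (e * w)) + conv_diff (- c) (L (e * w)) (w_of (e * w)))); [exact Hz| |].
  { intros w Hw. rewrite (proj2 (HF w Hw)), conv_sum_opp, conv_diff_opp by exact Hc0. reflexivity. }
  eapply is_cderive_value; [apply is_cderive_rotated_conv; auto|].
  unfold ds, dd. assert (H1 := disk_one_minus _ (Hdisk z Hz)). assert (Hw0 := w_of_neq_0 _ (Hdisk z Hz)).
  unfold dsum, ddiff. set (w := w_of (e * z)) in *. field. repeat split; assumption. }
assert (Hsp : sense_preserving F).
{ intros z Hz. unfold d_z, d_zbar.
  rewrite (C_derive_eq _ _ _ (DH z Hz)), (C_derive_eq _ _ _ (DG z Hz)), Cmod_conj.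
  (* As |e| = 1, the Jacobian is Re (ds conj(dd)), that is |dw/du|^2 times the quantity in
     [jacobian_conv]. *)
  rewrite (Cmod_mult (e ^ 2)), Cmod_pow, He1, pow1, Rmult_1_l, Cmod_sqr_half_sum_sub.
  assert (Hu := Hdisk z Hz). assert (H1 := disk_one_minus _ Hu).
  unfold ds, dd. set (v := 2 / (1 - e * z) ^ 2). set (w := w_of (e * z)).
  replace (v * dsum c w * Cconj (v * ddiff c w)) with (RtoC (Cmod v ^ 2) * (dsum c w * Cconj (ddiff c w)))
    by (rewrite Cmod2_conj, Cmult_conj; ring).
  rewrite re_scal_l. apply Rmult_lt_0_compat.
  - apply pow_lt, Cmod_gt_0. unfold v, Cdiv. apply Cmult_neq_0; [exact H2|].
    intros h. assert (E := Cinv_r ((1 - e * z) ^ 2) (Cpow_nz _ 2 H1)). rewrite h, Cmult_0_r in E. injection E; lra.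
  - apply jacobian_conv; [exact Hc|]. unfold w.
    destruct (w_of_cart _ Hu) as [Hd [-> _]]. apply disk_sqr in Hu. apply Rdiv_lt_0_compat; lra. }
(* With conj(e) = 1/e, the value e F is (S + T)/2 plus the conjugate of (S - T)/2, which is Re S + i
   Im T. *)
assert (Hval : forall z, disk z -> e * F z =
  (Re (conv_sum c (w_of (e * z))), Im (conv_diff c (L (e * z)) (w_of (e * z))))).
{ intros z Hz. destruct (HF z Hz) as [E1 E2]. unfold heval. rewrite E1, E2.
  set (S := conv_sum c (w_of (e * z))). set (T := conv_diff c (L (e * z)) (w_of (e * z))).
  assert (Hee : e * Cconj e = 1).
  { rewrite <- Cmod2_conj, He1. now rewrite pow1. }
  assert (E3 : Cconj (e / 2 * (S - T)) = Cconj e / 2 * Cconj (S - T)).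
  { rewrite Cmult_conj, Cdiv_conj by exact H2. do 2 f_equal. apply injective_projections; cbn; ring. }
  rewrite E3.
  transitivity ((S + T) / 2 + e * Cconj e * Cconj (S - T) / 2); [field; auto|].
  rewrite Hee. destruct S, T; apply injective_projections; cbn; field. }
assert (Hcoord : forall z, disk z -> exists r t, (0 < r)%R /\ (- (PI / 2) < t < PI / 2)%R /\
   w_of (e * z) = r * cis t /\
   (16 * c * Re (e * F z) = xi (c ^ 2) (c * r) t - 4 * c)%R /\
   (16 * c * Im (e * F z) = eta (c * r) t)%R).
{ intros z Hz. destruct (w_of_polar (e * z) (Hdisk z Hz)) as [r [t [Hr [Ht Hw]]]].
  exists r, t. rewrite (Hval z Hz). cbn [Re Im fst snd]. split; [exact Hr|split; [exact Ht|split; [exact Hw|]]].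
  rewrite Hw. apply conv_polar; [lra|exact Hr|].
  now apply (Im_log_polar L (e * z) r t); auto. }
assert (Hk : (0 < c ^ 2 <= 1)%R) by nra.
assert (Huniv : univalent F).
{ intros z1 z2 Hz1 Hz2 E.
  destruct (Hcoord z1 Hz1) as [r1 [t1 [Hr1 [Ht1 [Hw1 [X1 Y1]]]]]].
  destruct (Hcoord z2 Hz2) as [r2 [t2 [Hr2 [Ht2 [Hw2 [X2 Y2]]]]]].
  rewrite E in X1, Y1.
  destruct (xi_eta_inj (c ^ 2) (c * r1) (c * r2) t1 t2) as [Er Et]; auto; try nra.
  apply Rmult_eq_reg_l in Er; [|lra].
  assert (Eu : e * z1 = e * z2) by (apply w_of_inj; auto; rewrite Hw1, Hw2, Er, Et; reflexivity).
  transitivity (/ e * (e * z1)); [field; exact He0|]. rewrite Eu. field; exact He0. }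
assert (Hspu : sense_preserving_univalent F).
{ split; [split|split; [exact Hsp|split; [exact Huniv|]]].
  - intros z Hz; eexists; now apply DH.
  - intros z Hz; eexists; now apply DG.
  - unfold heval. destruct (HF 0 D0) as [-> ->].
    rewrite Cmult_0_r, L0.
    replace (w_of 0) with (RtoC 1) by (unfold w_of; field; apply RtoC_neq_0; lra).
    replace (conv_sum c 1) with (RtoC 0) by (unfold conv_sum; field).
    replace (conv_diff c 0 1) with (RtoC 0) by (unfold conv_diff; field; exact Hc0).
    apply injective_projections; cbn; ring. }
split; [exact Hspu|split; [now apply S_H0_affine_normalization|split; [|split; [exact Huniv|]]]].
- intros Ha0. split; [exact Hspu|].
  assert (Hc1 : c = 1%R) by (unfold c; rewrite Ha0; field).
  unfold d_z, d_zbar. rewrite (C_derive_eq _ _ _ (DH 0 D0)), (C_derive_eq _ _ _ (DG 0 D0)).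
  (* At z = 0 one has w = 1, and c = 1 makes both derivatives equal to 1. *)
  assert (Eds : ds 0 = 1).
  { unfold ds. rewrite Cmult_0_r. replace (w_of 0) with (RtoC 1) by (unfold w_of; field; apply RtoC_neq_0; lra).
    unfold dsum. rewrite Hc1. field. }
  assert (Edd : dd 0 = 1).
  { unfold dd. rewrite Cmult_0_r. replace (w_of 0) with (RtoC 1) by (unfold w_of; field; apply RtoC_neq_0; lra).
    unfold ddiff. rewrite Hc1. field. }
  rewrite Eds, Edd. split; [field|].
  replace (e ^ 2 * ((1 - 1) / 2)) with (RtoC 0) by field.
  apply injective_projections; cbn; ring.
- intros w0 x1 x2 x [z1 [Hz1 E1]] [z2 [Hz2 E2]] Hx.
  rewrite cis_opp in *. fold e in E1, E2 |- *.
  (* Multiplication by e makes the line of direction -alpha horizontal: Im (e F) is fixed on it and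
     Re (e F) is the shifted parameter. *)
  assert (Hshift : forall (v : R), e * (w0 + v * / e) = e * w0 + v) by (intros v; field; exact He0).
  assert (HshRe : forall v : R, Re (e * (w0 + v * / e)) = (Re (e * w0) + v)%R).
  { intros v. rewrite Hshift. now rewrite re_plus, re_RtoC. }
  assert (HshIm : forall v : R, Im (e * (w0 + v * / e)) = Im (e * w0)).
  { intros v. rewrite Hshift. destruct (e * w0); cbn; ring. }
  destruct (Hcoord z1 Hz1) as [r1 [t1 [Hr1 [Ht1 [Hw1 [X1 Y1]]]]]].
  destruct (Hcoord z2 Hz2) as [r2 [t2 [Hr2 [Ht2 [Hw2 [X2 Y2]]]]]].
  rewrite E1, HshRe in X1. rewrite E2, HshRe in X2. rewrite E1, HshIm in Y1. rewrite E2, HshIm in Y2.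
  (* The intermediate abscissa Re (e w0) + x, expressed in the coordinate xi = 16 c Re + 4 c. *)
  destruct (xi_eta_connected (c ^ 2) (c * r1) (c * r2) t1 t2 (16 * c * (Re (e * w0) + x) + 4 * c))
    as [rho [q [Hrho [Hq [Heta Hxi]]]]]; [exact Hk|nra|nra|exact Ht1|exact Ht2|lra|nra|].
  assert (Hr : (0 < rho / c)%R) by (apply Rdiv_lt_0_compat; lra).
  (* Since rho is c |w|, the point of the half-plane is (rho / c) cis q; its Cayley preimage u gives
     z = u / e. *)
  destruct (w_of_onto ((rho / c)%R * cis q)) as [u [Hu Hwu]].
  { rewrite re_scal_l. apply Rmult_lt_0_compat; [exact Hr|]. apply cos_gt_0; lra. }
  assert (Hz : disk (/ e * u)).
  { unfold disk. rewrite Cmod_mult, Cmod_inv, He1, Rinv_1, Rmult_1_l by exact He0. exact Hu. }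
  exists (/ e * u). split; [exact Hz|].
  assert (Hez : e * (/ e * u) = u) by (field; exact He0).
  assert (Hv := Hval _ Hz). rewrite Hez, Hwu in Hv.
  assert (HIm : Im (L u) = q) by (apply (Im_log_polar L u (rho / c)%R q); auto).
  destruct (conv_polar c (rho / c) q (L u)) as [P1 P2]; try lra.
  replace (c * (rho / c))%R with rho in P1, P2 by (field; lra).
  assert (HFe : e * F (/ e * u) = e * w0 + x).
  { rewrite Hv. apply injective_projections; cbn [fst snd].
    - change (fst (e * w0 + x)) with (Re (e * w0 + x)). rewrite re_plus, re_RtoC.
      apply (Rmult_eq_reg_l (16 * c)); [rewrite P1, Hxi; ring|lra].
    - replace (snd (e * w0 + x)) with (Im (e * w0)) by (destruct (e * w0); cbn; ring).
      apply (Rmult_eq_reg_l (16 * c)); [rewrite P2, Heta; lra|lra]. }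
  transitivity (/ e * (e * F (/ e * u))); [field; exact He0|].
  rewrite HFe. field; exact He0.
Qed.
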